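(* Let $G$ be a complex simple Lie group of type $ADE$, $P\le G$ a parabolic subgroup, and let $E$ be a multiplicity free homogeneous vector bundle of rank $r$ on $G/P$. Let $k$ be the number of connected components of the quiver $\mathcal{Q}|_E$. Then $H^0(\operatorname{End} E)^{\mathbb{C}}=\mathbb{C}^k$. In particular, if $\mathcal{Q}|_E$ is connected, then $E$ is weakly simple, i.e. $H^0(\operatorname{End} E)^{\mathbb{C}}=\mathbb{C}$.
   Context: Write $\mathfrak{p}=\operatorname{Lie}P=\mathfrak{r}\oplus\mathfrak{n}$, where $P=R\cdot N$ with $R$ reductive and $N$ nilpotent, $\mathfrak r=\operatorname{Lie}R$, $\mathfrak n=\operatorname{Lie}N$. A vector bundle $E$ on $G/P$ is ($G$-)homogeneous if $G$ acts on $E$ compatibly with its natural action on $G/P$; such bundles correspond to finite dimensional representations of $P$ (equivalently, $\mathfrak p$-modules). For a dominant weight $\lambda$ of $R$, $E_\lambda$ denotes the homogeneous bundle corresponding to the irreducible representation of $P$ with highest weight $\lambda$ (on which $\mathfrak n$ acts trivially). Quiver $\mathcal{Q}_{G/P}$: the vertices are the dominant weights $\lambda$ for $R$; there is an arrow $\lambda\to\mu$ if and only if $\operatorname{Hom}(\mathfrak n\otimes E_\lambda,E_\mu)^G\neq 0$ (invariant homomorphisms, i.e. $R$-equivariant maps of the corresponding $\mathfrak r$-modules, $\mathfrak n$ being an $\mathfrak r$-module by the adjoint action). In type $ADE$ this space has dimension $0$ or $1$. Graded bundle: $\operatorname{gr}E$ is $E$ viewed as an $\mathfrak r$-module, decomposed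 as $\operatorname{gr}E=\bigoplus_\lambda E_\lambda\otimes V_\lambda$ with multiplicity spaces $V_\lambda$. Representation $[E]$ of $\mathcal{Q}_{G/P}$: it assigns $V_\lambda$ to the vertex $\lambda$. The action of $\mathfrak n$ gives $\theta:\mathfrak n\otimes\operatorname{gr}E\to\operatorname{gr}E$, an $\mathfrak r$-equivariant map; choosing a generator $f_{\lambda\mu}$ of each non-zero $\operatorname{Hom}(\mathfrak n\otimes E_\lambda,E_\mu)^G$, write $\theta=\sum_{\lambda,\mu}g_{\lambda\mu}f_{\lambda\mu}$ with $g_{\lambda\mu}\in\operatorname{Hom}(V_\lambda,V_\mu)$; then $[E]$ assigns $g_{\lambda\mu}$ to the arrow $\lambda\to\mu$. $\mathcal{Q}|_E$ is the subquiver of $\mathcal{Q}_{G/P}$ given by all vertices where $[E]$ is non-zero and all arrows connecting any two such vertices. If its vertices are $\lambda_1,\dots,\lambda_n$, so $\operatorname{gr}E=\bigoplus_{i=1}^nE_{\lambda_i}\otimes V_i$, then $E$ is called multiplicity free if $\dim V_i=1$ for all $i$. $H^0(\operatorname{End}E)^{\mathbb C}$ denotes the isotypical component of the $G$-module $H^0(\operatorname{End}E)$ for the trivial representation $\mathbb C$, i.e. the space of $G$-invariant endomorphisms of $E$. $E$ is called weakly simple if $H^0(\operatorname{End} E)^{\mathbb{C}}=\mathbb{C}$.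
   Formalization: Q|_E is taken with only those arrows between its vertices on which [E] is non-zero (g_{λμ} ≠ 0); with all arrows of Q_{G/P} the claim fails, e.g. for O⊕Ω^1 on P^n, whose quiver is connected while its invariant endomorphisms are C^2. *)

(* Defs.v *)
(* MathComp / MathComp-Analysis.  The complex numbers are R[i], R : realType. *)
From HB Require Import structures.
From mathcomp Require Import all_boot all_order all_algebra.
From mathcomp Require Import all_classical all_reals all_analysis.
From mathcomp Require Import complex.

Set Implicit Arguments.
Unset Strict Implicit.
Unset Printing Implicit Defensive.

Import Order.TTheory GRing.Theory Num.Theory.
Import numFieldNormedType.Exports.
Local Open Scope ring_scope.
Local Open Scope complex_scope.

Definition limC (R : realType) (u : nat -> R[i]) : R[i] :=
  limn (fun n => complex.Re (u n)) +i* limn (fun n => complex.Im (u n)).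

Definition mexp (R : realType) (m : nat) (X : 'M[R[i]]_m) : 'M[R[i]]_m :=
  \matrix_(i, j) limC (fun n => (\sum_(k < n) (k`!%:R^-1) *: (X ^+ k)) i j).

Definition lie (R : realType) (m : nat) (X Y : 'M[R[i]]_m) : 'M[R[i]]_m :=
  X *m Y - Y *m X.

Inductive lspan (R : realType) (m : nat) (S : 'M[R[i]]_m -> Prop) :
    'M[R[i]]_m -> Prop :=
| lspan0 : lspan S 0
| lspanS (a : R[i]) X Y : S X -> lspan S Y -> lspan S (a *: X + Y).

(* The analytic subgroup of GL_m with Lie algebra a; it is closed under
   inverses because mexp (- X) is the inverse of mexp X. *)
Inductive analytic_subgroup (R : realType) (m : nat)
    (a : {vspace 'M[R[i]]_m}) : 'M[R[i]]_m -> Prop :=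
| analytic_one : analytic_subgroup a 1%:M
| analytic_mul X x :
    X \in a -> analytic_subgroup a x -> analytic_subgroup a (mexp X *m x).

Definition lie_subalgebra (R : realType) (m : nat)
    (a : {vspace 'M[R[i]]_m}) : Prop :=
  forall X Y, X \in a -> Y \in a -> lie X Y \in a.

Definition simple_lie (R : realType) (m : nat)
    (g : {vspace 'M[R[i]]_m}) : Prop :=
  [/\ lie_subalgebra g,
      exists X Y, [/\ X \in g, Y \in g & lie X Y <> 0] &
      forall a : {vspace 'M[R[i]]_m}, (a <= g)%VS ->
        (forall X Y, X \in g -> Y \in a -> lie X Y \in a) ->
        a = 0%VS \/ a = g].

Definition root_vector (R : realType) (m : nat) (g h : {vspace 'M[R[i]]_m})
    (a : 'Hom(subvs_of h, R[i]^o)) (X : 'M[R[i]]_m) : Prop :=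
  X \in g /\ forall H : subvs_of h, lie (vsval H) X = (a H : R[i]) *: X.

(* In a semisimple Lie algebra the Cartan subalgebras are the abelian,
   ad-diagonalizable, self-centralizing subalgebras. *)
Definition cartan_subalgebra (R : realType) (m : nat)
    (g h : {vspace 'M[R[i]]_m}) : Prop :=
  [/\ (h <= g)%VS,
      forall X Y, X \in h -> Y \in h -> lie X Y = 0,
      forall X, X \in g ->
        lspan (fun Y => exists a : 'Hom(subvs_of h, R[i]^o),
                 root_vector g a Y) X &
      forall X, X \in g -> (forall H, H \in h -> lie H X = 0) -> X \in h].

Definition is_root (R : realType) (m : nat) (g h : {vspace 'M[R[i]]_m})
    (a : 'Hom(subvs_of h, R[i]^o)) : Prop :=
  a <> 0 /\ exists2 X, root_vector g a X & X <> 0.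

Definition nat_comb (R : realType) (m : nat) (h : {vspace 'M[R[i]]_m})
    (l : nat) (D : 'I_l -> 'Hom(subvs_of h, R[i]^o))
    (a : 'Hom(subvs_of h, R[i]^o)) : Prop :=
  exists c : 'I_l -> nat, a = \sum_(i < l) D i *+ c i.

Definition is_base (R : realType) (m : nat) (g h : {vspace 'M[R[i]]_m})
    (l : nat) (D : 'I_l -> 'Hom(subvs_of h, R[i]^o)) : Prop :=
  [/\ forall i, is_root g (D i),
      free [seq D i | i <- enum 'I_l] &
      forall a, is_root g a -> nat_comb D a \/ nat_comb D (- a)].

Definition is_coroot (R : realType) (m : nat) (g h : {vspace 'M[R[i]]_m})
    (a : 'Hom(subvs_of h, R[i]^o)) (H : subvs_of h) : Prop :=
  a H = 2 /\ exists e f, [/\ root_vector g a e, root_vector g (- a) f &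
                            vsval H = lie e f].

Inductive ade_type := typeA | typeD | typeE.

Definition ade_rank (t : ade_type) (l : nat) : bool :=
  match t with
  | typeA => (1 <= l)%N
  | typeD => (4 <= l)%N
  | typeE => (6 <= l <= 8)%N
  end.

Definition chain_edge (i j : nat) : bool := (i.+1 == j) || (j.+1 == i).

(* The chain 0 - 1 - ... - (l-2), with the node l-1 attached to the node b. *)
Definition branch_edge (b l i j : nat) : bool :=
  if i == l.-1 then j == b
  else if j == l.-1 then i == b
  else chain_edge i j.

Definition dynkin_edge (t : ade_type) (l i j : nat) : bool :=
  match t with
  | typeA => chain_edge i j
  | typeD => branch_edge (l - 3) l i j
  | typeE => branch_edge 2 l i j
  end.

Definition cartan_integer (t : ade_type) (l i j : nat) : int :=
  if i == j then 2 else if dynkin_edge t l i j then -1 else 0.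

(* A (connected) complex simple Lie group is linear, hence the analytic
   subgroup of some GL_m attached to a simple Lie subalgebra of gl_m.  The
   record also fixes a Cartan subalgebra and a base of the root system;
   quantifying over them loses nothing, since every parabolic subgroup contains
   the Borel subgroup attached to some such choice. *)
Record adeGroup (R : realType) (m : nat) := AdeGroup {
  lieG : {vspace 'M[R[i]]_m};
  cartan : {vspace 'M[R[i]]_m};
  rk : nat;
  simple_root : 'I_rk -> 'Hom(subvs_of cartan, R[i]^o);
  coroot : 'I_rk -> subvs_of cartan;
  lieG_simple : simple_lie lieG;
  cartanP : cartan_subalgebra lieG cartan;
  simple_rootP : is_base lieG simple_root;
  corootP : forall i, is_coroot lieG (simple_root i) (coroot i);
  adeP : exists2 t, ade_rank t rk &
    forall i j, simple_root j (coroot i) = (cartan_integer t rk i j)%:~R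
}.

Definition wt (R : realType) (m : nat) (G : adeGroup R m) : Type :=
  'Hom(subvs_of (cartan G), R[i]^o).

Definition inG (R : realType) (m : nat) (G : adeGroup R m)
    (x : 'M[R[i]]_m) : Prop := analytic_subgroup (lieG G) x.

Definition positive_root (R : realType) (m : nat) (G : adeGroup R m)
    (a : wt G) : Prop :=
  is_root (lieG G) a /\ nat_comb (@simple_root R m G) a.

Definition root_in (R : realType) (m : nat) (G : adeGroup R m)
    (p : {vspace 'M[R[i]]_m}) (a : wt G) : Prop :=
  forall X, root_vector (lieG G) a X -> X \in p.

(* Subalgebras containing the Borel subalgebra of the chosen base. *)
Record parabolic (R : realType) (m : nat) (G : adeGroup R m) := Parabolic {
  lieP : {vspace 'M[R[i]]_m};
  lieP_subalgebra : lie_subalgebra lieP;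
  lieP_sub : (lieP <= lieG G)%VS;
  cartan_sub : (cartan G <= lieP)%VS;
  borel_sub : forall a : wt G, positive_root a -> root_in lieP a
}.

(* Parabolic subgroups are connected, so P is generated by exp (lieP P). *)
Definition inP (R : realType) (m : nat) (G : adeGroup R m) (P : parabolic G)
    (x : 'M[R[i]]_m) : Prop := analytic_subgroup (lieP P) x.

Definition levi (R : realType) (m : nat) (G : adeGroup R m)
    (P : parabolic G) : 'M[R[i]]_m -> Prop :=
  lspan (fun X => X \in cartan G \/
    exists a : wt G, [/\ is_root (lieG G) a, root_in (lieP P) a,
                         root_in (lieP P) (- a) & root_vector (lieG G) a X]).

Definition nilrad (R : realType) (m : nat) (G : adeGroup R m)
    (P : parabolic G) : 'M[R[i]]_m -> Prop :=
  lspan (fun X =>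
    exists a : wt G, [/\ is_root (lieG G) a, root_in (lieP P) a,
                         ~ root_in (lieP P) (- a) & root_vector (lieG G) a X]).

(* Integrality is with respect to the maximal torus exp(h) of G: the weight
   is the differential of a character of that torus. *)
Definition integral_weight (R : realType) (m : nat) (G : adeGroup R m)
    (lam : wt G) : Prop :=
  forall H : subvs_of (cartan G), mexp (vsval H) = 1%:M ->
    mexp ((lam H : R[i])%:M : 'M[R[i]]_1) = 1%:M.

(* Dominance is imposed only on the simple roots of the Levi factor. *)
Definition dominant (R : realType) (m : nat) (G : adeGroup R m)
    (P : parabolic G) (lam : wt G) : Prop :=
  integral_weight lam /\
  forall i : 'I_(rk G), root_in (lieP P) (- simple_root i : wt G) ->
    exists n : nat, lam (coroot i) = n%:R.

Definition lie_rep (R : realType) (m : nat) (p : {vspace 'M[R[i]]_m})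
    (d : nat) (s : 'M[R[i]]_m -> 'M[R[i]]_d) : Prop :=
  forall X Y, X \in p -> Y \in p -> s (lie X Y) = lie (s X) (s Y).

(* A homogeneous bundle E = G x_P C^r of rank r, given by the corresponding
   holomorphic representation rho of P on C^r, with differential drho.  As P
   is connected, compatibility of rho and drho with the exponential maps says
   that rho is holomorphic with differential drho.  Only the values of rho on
   P and of drho on lieP P are relevant. *)
Record homBundle (R : realType) (m : nat) (G : adeGroup R m)
    (P : parabolic G) (r : nat) := HomBundle {
  rho : 'M[R[i]]_m -> 'M[R[i]]_r;
  drho : {linear 'M[R[i]]_m -> 'M[R[i]]_r};
  rho1 : rho 1%:M = 1%:M;
  rhoM : forall x y, inP P x -> inP P y -> rho (x *m y) = rho x *m rho y;
  drho_rep : lie_rep (lieP P) drho;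
  rho_exp : forall X, X \in lieP P -> rho (mexp X) = mexp (drho X)
}.

Definition holomorphic_on (R : realType) (m r : nat) (G : adeGroup R m)
    (s : 'M[R[i]]_m -> 'M[R[i]]_r) : Prop :=
  forall x, inG G x -> exists L : {linear 'M[R[i]]_m -> 'M[R[i]]_r},
    forall e : R[i], 0 < e -> exists2 d : R[i], 0 < d &
      forall X, X \in lieG G -> mx_norm X < d ->
        mx_norm (s (x *m mexp X) - s x - L X) <= e * mx_norm X.

(* H^0(End E): holomorphic sections of G x_P End(C^r), as P-equivariant
   functions on G.  Functions agreeing on G are the same section. *)
Definition H0_End (R : realType) (m : nat) (G : adeGroup R m)
    (P : parabolic G) (r : nat) (E : homBundle P r)
    (s : 'M[R[i]]_m -> 'M[R[i]]_r) : Prop :=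
  holomorphic_on G s /\
  forall x y, inG G x -> inP P y ->
    s (x *m y) = invmx (rho E y) *m s x *m rho E y.

Definition translate (R : realType) (m r : nat) (x : 'M[R[i]]_m)
    (s : 'M[R[i]]_m -> 'M[R[i]]_r) : 'M[R[i]]_m -> 'M[R[i]]_r :=
  fun y => s (invmx x *m y).

Definition H0_End_inv (R : realType) (m : nat) (G : adeGroup R m)
    (P : parabolic G) (r : nat) (E : homBundle P r)
    (s : 'M[R[i]]_m -> 'M[R[i]]_r) : Prop :=
  H0_End E s /\
  forall x y, inG G x -> inG G y -> translate x s y = s y.

(* S, a set of functions considered up to agreement on G, is a vector space
   isomorphic to C^k. *)
Definition iso_Ck (R : realType) (m r : nat) (G : adeGroup R m)
    (S : ('M[R[i]]_m -> 'M[R[i]]_r) -> Prop) (k : nat) : Prop :=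
  exists b : 'I_k -> 'M[R[i]]_m -> 'M[R[i]]_r,
    (forall c : 'rV[R[i]]_k, S (fun x => \sum_(i < k) c 0 i *: b i x)) /\
    (forall s, S s -> exists! c : 'rV[R[i]]_k,
       forall x, inG G x -> s x = \sum_(i < k) c 0 i *: b i x).

Definition weakly_simple (R : realType) (m : nat) (G : adeGroup R m)
    (P : parabolic G) (r : nat) (E : homBundle P r) : Prop :=
  iso_Ck G (H0_End_inv E) 1.

(* The irreducible lieP P-module of highest weight lam. *)
Definition irreducible_of_weight (R : realType) (m : nat) (G : adeGroup R m)
    (P : parabolic G) (lam : wt G) (d : nat)
    (s : 'M[R[i]]_m -> 'M[R[i]]_d) : Prop :=
  [/\ lie_rep (lieP P) s,
      forall Y, nilrad P Y -> s Y = 0,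
      forall U : {vspace 'cV[R[i]]_d},
        (forall X u, X \in lieP P -> u \in U -> s X *m u \in U) ->
        U = 0%VS \/ U = fullv &
      exists v : 'cV[R[i]]_d,
        [/\ v <> 0,
            forall H : subvs_of (cartan G),
              s (vsval H) *m v = (lam H : R[i]) *: v &
            forall (a : wt G) X, positive_root a ->
              root_vector (lieG G) a X -> s X *m v = 0]].

(* A choice of model E_lam for each dominant weight lam (unique up to
   isomorphism); the value at other weights is irrelevant. *)
Record irrFamily (R : realType) (m : nat) (G : adeGroup R m)
    (P : parabolic G) := IrrFamily {
  idim : wt G -> nat;
  irep : forall lam : wt G, {linear 'M[R[i]]_m -> 'M[R[i]]_(idim lam)};
  irepP : forall lam, dominant P lam -> irreducible_of_weight P lam (irep lam)
}.

(* F, restricted to n, is an element of Hom(n (x) E_lam, E_mu)^R. *)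
Definition equivariant_hom (R : realType) (m : nat) (G : adeGroup R m)
    (P : parabolic G) (I : irrFamily P) (lam mu : wt G)
    (F : {linear 'M[R[i]]_m -> 'M[R[i]]_(idim I mu, idim I lam)}) : Prop :=
  forall X Y, levi P X -> nilrad P Y ->
    irep I mu X *m F Y = F (lie X Y) + F Y *m irep I lam X.

Definition arrow (R : realType) (m : nat) (G : adeGroup R m)
    (P : parabolic G) (I : irrFamily P) (lam mu : wt G) : Prop :=
  exists F : {linear 'M[R[i]]_m -> 'M[R[i]]_(idim I mu, idim I lam)},
    equivariant_hom F /\ exists2 Y, nilrad P Y & F Y <> 0.

(* f spans Hom(n (x) E_lam, E_mu)^R, a space of dimension 0 or 1 in type ADE;
   it vanishes on n when that space is zero. *)
Definition generates (R : realType) (m : nat) (G : adeGroup R m)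
    (P : parabolic G) (I : irrFamily P) (lam mu : wt G)
    (f : {linear 'M[R[i]]_m -> 'M[R[i]]_(idim I mu, idim I lam)}) : Prop :=
  equivariant_hom f /\
  forall F : {linear 'M[R[i]]_m -> 'M[R[i]]_(idim I mu, idim I lam)},
    equivariant_hom F ->
    exists c : R[i], forall Y, nilrad P Y -> F Y = c *: f Y.

Record generators (R : realType) (m : nat) (G : adeGroup R m)
    (P : parabolic G) (I : irrFamily P) := Generators {
  gen : forall lam mu : wt G,
    {linear 'M[R[i]]_m -> 'M[R[i]]_(idim I mu, idim I lam)};
  genP : forall lam mu, dominant P lam -> dominant P mu ->
    generates (gen lam mu)
}.

(* gr E = (+)_i E_(lam i) (x) V_i with V_i = C^(mult i) non-zero and the lam i
   distinct: emb i a is the embedding of E_(lam i) (x) e_a into E. *)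
Record gradedBundle (R : realType) (m : nat) (G : adeGroup R m)
    (P : parabolic G) (r : nat) (E : homBundle P r) (I : irrFamily P) :=
  GradedBundle {
  nvert : nat;
  vert : 'I_nvert -> wt G;
  mult : 'I_nvert -> nat;
  emb : forall i, 'I_(mult i) -> 'M[R[i]]_(r, idim I (vert i));
  vert_inj : injective vert;
  vert_dominant : forall i, dominant P (vert i);
  mult_gt0 : forall i, (0 < mult i)%N;
  emb_levi : forall i a X, levi P X ->
    drho E X *m @emb i a = @emb i a *m irep I (vert i) X;
  emb_iso : forall w : 'cV[R[i]]_r,
    exists! u : forall i, 'I_(mult i) -> 'cV[R[i]]_(idim I (vert i)),
      w = \sum_i \sum_(a < mult i) @emb i a *m u i a
}.

(* The representation [E] on the arrows: gmap i j is the matrix of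
   g_(lam i, lam j) : V_i -> V_j in theta = sum g_(lam, mu) f_(lam, mu). *)
Record quiverRep (R : realType) (m : nat) (G : adeGroup R m)
    (P : parabolic G) (r : nat) (E : homBundle P r) (I : irrFamily P)
    (f : generators I) (D : gradedBundle E I) := QuiverRep {
  gmap : forall i j : 'I_(nvert D), 'M[R[i]]_(mult j, mult i);
  gmapP : forall Y (i : 'I_(nvert D)) (a : 'I_(mult i)), nilrad P Y ->
    drho E Y *m emb a =
      \sum_j \sum_(b < mult j)
        gmap i j b a *: (emb b *m gen f (vert i) (vert j) Y)
}.

Definition multiplicity_free (R : realType) (m : nat) (G : adeGroup R m)
    (P : parabolic G) (r : nat) (E : homBundle P r) (I : irrFamily P)
    (D : gradedBundle E I) : Prop :=
  forall i : 'I_(nvert D), mult i = 1%N.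

(* The arrows of Q|_E: those arrows of Q_{G/P} between vertices of Q|_E on
   which [E] is non-zero.  Arrows on which [E] vanishes have to be left out:
   on P^n the bundle O (+) Omega^1 is multiplicity free, its two weights are
   joined by an arrow of Q_{G/P}, and it has a 2-dimensional space of
   invariant endomorphisms. *)
Definition support_arrow (R : realType) (m : nat) (G : adeGroup R m)
    (P : parabolic G) (r : nat) (E : homBundle P r) (I : irrFamily P)
    (f : generators I) (D : gradedBundle E I) (Q : quiverRep f D)
    (i j : 'I_(nvert D)) : Prop :=
  arrow I (vert i) (vert j) /\ gmap Q i j <> 0.

Definition adjacent (R : realType) (m : nat) (G : adeGroup R m)
    (P : parabolic G) (r : nat) (E : homBundle P r) (I : irrFamily P)
    (f : generators I) (D : gradedBundle E I) (Q : quiverRep f D) :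
    rel 'I_(nvert D) :=
  fun i j => `[< support_arrow Q i j \/ support_arrow Q j i >].

Definition nb_components (R : realType) (m : nat) (G : adeGroup R m)
    (P : parabolic G) (r : nat) (E : homBundle P r) (I : irrFamily P)
    (f : generators I) (D : gradedBundle E I) (Q : quiverRep f D) : nat :=
  n_comp (adjacent Q) 'I_(nvert D).

Definition quiver_connected (R : realType) (m : nat) (G : adeGroup R m)
    (P : parabolic G) (r : nat) (E : homBundle P r) (I : irrFamily P)
    (f : generators I) (D : gradedBundle E I) (Q : quiverRep f D) : Prop :=
  (0 < nvert D)%N /\ forall i j, connect (adjacent Q) i j.

(* Main.v *)
Require Import Defs.
From HB Require Import structures.
From mathcomp Require Import all_boot all_order all_algebra.
From mathcomp Require Import all_classical all_reals all_analysis.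
From mathcomp Require Import complex.
From mathcomp Require Import ring lra zify.

(** An invariant section of End E is constant on G, equal to its value A at the base
    point, and the sections obtained in this way are the matrices A commuting with
    rho(P) ([invariant_section], [constant_section]).  Since P is generated by
    exponentials, these are the matrices commuting with drho(p): one differentiates
    the commutation with exp (t X) at t = 0 ([mexp_comm_inv]).

    The algebra p is the sum of its Levi part r and its nilradical n
    ([parabolic_levi_nilrad]).  The positive root spaces lie in p, and a negative one
    does as soon as p meets it, because it is a line; this is shown by induction on
    the height, from the representation theory of the sl2-triples of
    the simple roots ([simple_lowering_surj]) and from the positivity of the Cartan
    matrix of type ADE ([cartan_positive_pairing]).  As n acts by zero on each
    E_lambda, the E_lambda are then irreducible r-modules, pairwise non-isomorphic
    because the highest weight of an irreducible module is unique
    ([highest_weight_unique]).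

    By Schur's lemma and multiplicity freeness, a matrix A commuting with r acts on
    the summand E_(lambda_i) of gr E by a scalar a_i ([levi_endomorphism]).  For Y in
    n the component from E_(lambda_i) to E_(lambda_j) of drho(Y) is g_ij f_ij(Y), and
    commutation with it says that (a_i - a_j) g_ij f_ij(Y) = 0.  Hence A commutes
    with n exactly when a is constant along the arrows of the support of the
    representation ([diagonal_endo_nilrad]), that is, constant on the connected
    components; a choice of one scalar for each component gives the isomorphism with
    C^k ([invariant_endomorphisms]). *)

Set Implicit Arguments.
Unset Strict Implicit.
Unset Printing Implicit Defensive.

Import Order.TTheory GRing.Theory Num.Theory.
Import numFieldNormedType.Exports.
Local Open Scope classical_set_scope.
Local Open Scope ring_scope.
Local Open Scope complex_scope.

(** * The matrix exponential *)

Section ComplexNorm.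
Context {R : realType}.
Implicit Types z w : R[i].

(** The l1 norm on C = R^2; real-valued, and submultiplicative. *)
Definition cnorm1 z : R := `|complex.Re z| + `|complex.Im z|.

Lemma cnorm1_ge0 z : 0 <= cnorm1 z.
Proof. by rewrite addr_ge0. Qed.

Lemma cnorm10 : cnorm1 0 = 0.
Proof. by rewrite /cnorm1 /= normr0 addr0. Qed.

Lemma cnorm1_eq0 z : cnorm1 z = 0 -> z = 0.
Proof.
case: z => a b; rewrite /cnorm1 /= => /eqP.
by rewrite paddr_eq0 // !normr_eq0 => /andP[/eqP-> /eqP->].
Qed.

Lemma cnorm1D z w : cnorm1 (z + w) <= cnorm1 z + cnorm1 w.
Proof.
case: z => a b; case: w => c d; rewrite /cnorm1 /=.
by rewrite [leRHS]addrACA lerD // ler_normD.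
Qed.

Lemma cnorm1N z : cnorm1 (- z) = cnorm1 z.
Proof. by case: z => a b; rewrite /cnorm1 /= !normrN. Qed.

Lemma cnorm1M z w : cnorm1 (z * w) <= cnorm1 z * cnorm1 w.
Proof.
case: z => a b; case: w => c d; rewrite /cnorm1 /=.
have h1 := ler_normB (a * c) (b * d); have h2 := ler_normD (a * d) (b * c).
rewrite !normrM in h1 h2; apply: le_trans (lerD h1 h2) _.
by rewrite le_eqVlt; apply/orP; left; apply/eqP; ring.
Qed.

Lemma cnorm1_real (x : R) : cnorm1 x%:C = `|x|.
Proof. by rewrite /cnorm1 /= normr0 addr0. Qed.

Lemma cnorm1_sum I (r : seq I) (p : pred I) (F : I -> R[i]) :
  cnorm1 (\sum_(i <- r | p i) F i) <= \sum_(i <- r | p i) cnorm1 (F i).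
Proof.
elim/big_ind2: _ => [|z x w y hz hw|//]; first by rewrite cnorm10.
by apply: le_trans (cnorm1D _ _) _; apply: lerD.
Qed.

Lemma Re_sum I (r : seq I) (p : pred I) (F : I -> R[i]) :
  complex.Re (\sum_(i <- r | p i) F i) = \sum_(i <- r | p i) complex.Re (F i).
Proof. by apply: (big_morph _ _ (erefl _)) => -[? ?] []. Qed.

Lemma Im_sum I (r : seq I) (p : pred I) (F : I -> R[i]) :
  complex.Im (\sum_(i <- r | p i) F i) = \sum_(i <- r | p i) complex.Im (F i).
Proof. by apply: (big_morph _ _ (erefl _)) => -[? ?] []. Qed.

End ComplexNorm.

Section MatrixNorm.
Context {R : realType}.

(** The entrywise l1 norm of a matrix; submultiplicative, but the identity
    matrix does not have norm 1. *)
Definition mnorm1 m n (X : 'M[R[i]]_(m, n)) : R := \sum_i \sum_j cnorm1 (X i j).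

Lemma mnorm1_ge0 m n (X : 'M[R[i]]_(m, n)) : 0 <= mnorm1 X.
Proof. by apply: sumr_ge0 => i _; apply: sumr_ge0 => j _; apply: cnorm1_ge0. Qed.

Lemma mnorm1_entry m n (X : 'M[R[i]]_(m, n)) i j : cnorm1 (X i j) <= mnorm1 X.
Proof.
rewrite /mnorm1 (bigD1 i) //= (bigD1 j) //= -addrA lerDl addr_ge0 //.
  by apply: sumr_ge0 => k _; apply: cnorm1_ge0.
by apply: sumr_ge0 => k _; apply: sumr_ge0 => l _; apply: cnorm1_ge0.
Qed.

Lemma mnorm1_eq0 m n (X : 'M[R[i]]_(m, n)) : mnorm1 X = 0 -> X = 0.
Proof.
move=> X0; apply/matrixP => i j; rewrite mxE; apply: cnorm1_eq0.
by apply/eqP; rewrite eq_le cnorm1_ge0 -X0 mnorm1_entry.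
Qed.

Lemma mnorm10 m n : mnorm1 (0 : 'M[R[i]]_(m, n)) = 0.
Proof. by apply: big1 => i _; apply: big1 => j _; rewrite mxE cnorm10. Qed.

Lemma mnorm1D m n (X Y : 'M[R[i]]_(m, n)) : mnorm1 (X + Y) <= mnorm1 X + mnorm1 Y.
Proof.
rewrite /mnorm1 -big_split; apply: ler_sum => i _ /=.
by rewrite -big_split; apply: ler_sum => j _ /=; rewrite mxE cnorm1D.
Qed.

Lemma mnorm1N m n (X : 'M[R[i]]_(m, n)) : mnorm1 (- X) = mnorm1 X.
Proof. by apply: eq_bigr => i _; apply: eq_bigr => j _; rewrite mxE cnorm1N. Qed.

Lemma mnorm1Z m n a (X : 'M[R[i]]_(m, n)) : mnorm1 (a *: X) <= cnorm1 a * mnorm1 X.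
Proof.
rewrite /mnorm1 mulr_sumr; apply: ler_sum => i _ /=.
by rewrite mulr_sumr; apply: ler_sum => j _ /=; rewrite mxE cnorm1M.
Qed.

Lemma mnorm1_sum m n I (r : seq I) (p : pred I) (F : I -> 'M[R[i]]_(m, n)) :
  mnorm1 (\sum_(i <- r | p i) F i) <= \sum_(i <- r | p i) mnorm1 (F i).
Proof.
elim/big_ind2: _ => [|z x w y hz hw|//]; first by rewrite mnorm10.
by apply: le_trans (mnorm1D _ _) _; apply: lerD.
Qed.

Lemma mnorm1M m n p (X : 'M[R[i]]_(m, n)) (Y : 'M[R[i]]_(n, p)) :
  mnorm1 (X *m Y) <= mnorm1 X * mnorm1 Y.
Proof.
rewrite {1 2}/mnorm1 mulr_suml; apply: ler_sum => i _.
rewrite mulr_suml.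
apply: (@le_trans _ _ (\sum_j \sum_k cnorm1 (X i k) * cnorm1 (Y k j))).
  apply: ler_sum => j _; rewrite mxE; apply: le_trans (cnorm1_sum _ _ _) _.
  by apply: ler_sum => k _; apply: cnorm1M.
rewrite exchange_big /=; apply: ler_sum => k _; rewrite -mulr_sumr.
apply: ler_wpM2l; first exact: cnorm1_ge0.
rewrite /mnorm1 (bigD1 k) //= lerDl.
by apply: sumr_ge0 => l _; apply: sumr_ge0 => j _; apply: cnorm1_ge0.
Qed.

Lemma mnorm1X m (X : 'M[R[i]]_m) k :
  mnorm1 (X ^+ k) <= mnorm1 (1%:M : 'M[R[i]]_m) * mnorm1 X ^+ k.
Proof.
elim: k => [|k IH]; first by rewrite !expr0 mulr1.
rewrite !exprSr mulrA; apply: le_trans (mnorm1M _ _) _.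
by apply: ler_wpM2r => //; apply: mnorm1_ge0.
Qed.

(** Convergence of a sequence of matrices in the norm [mnorm1]. *)
Definition mcvg m n (U : nat -> 'M[R[i]]_(m, n)) (L : 'M[R[i]]_(m, n)) : Prop :=
  forall e : R, 0 < e -> exists N, forall k, (N <= k)%N -> mnorm1 (U k - L) < e.

Lemma mcvg_unique m n (U : nat -> 'M[R[i]]_(m, n)) L L' :
  mcvg U L -> mcvg U L' -> L = L'.
Proof.
move=> hL hL'; apply/eqP; rewrite -subr_eq0; apply/eqP/mnorm1_eq0/eqP.
rewrite eq_le mnorm1_ge0 andbT; apply/ler_addgt0Pr => e e0; rewrite add0r.
have e2 : 0 < e / 2 by rewrite divr_gt0.
have [N hN] := hL _ e2; have [N' hN'] := hL' _ e2.
have := hN (maxn N N') (leq_maxl _ _); have := hN' (maxn N N') (leq_maxr _ _).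
set V := U _ => h1 h2.
have -> : L - L' = - (V - L) + (V - L') by rewrite opprB addrA subrK.
by apply: le_trans (mnorm1D _ _) _; rewrite mnorm1N; lra.
Qed.

Lemma mcvgMl m n p (A : 'M[R[i]]_(p, m)) (U : nat -> 'M[R[i]]_(m, n)) L :
  mcvg U L -> mcvg (fun k => A *m U k) (A *m L).
Proof.
move=> h e e0; have a0 : 0 < mnorm1 A + 1 by rewrite ltr_wpDl ?mnorm1_ge0.
have [N hN] := h (e / (mnorm1 A + 1)) (divr_gt0 e0 a0).
exists N => k /hN; rewrite ltr_pdivlMr // -mulmxBr => hk.
apply: le_lt_trans (mnorm1M _ _) _; apply: le_lt_trans hk.
by rewrite mulrC ler_wpM2l ?mnorm1_ge0 // lerDl.
Qed.

Lemma mcvgMr m n p (A : 'M[R[i]]_(n, p)) (U : nat -> 'M[R[i]]_(m, n)) L :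
  mcvg U L -> mcvg (fun k => U k *m A) (L *m A).
Proof.
move=> h e e0; have a0 : 0 < mnorm1 A + 1 by rewrite ltr_wpDl ?mnorm1_ge0.
have [N hN] := h (e / (mnorm1 A + 1)) (divr_gt0 e0 a0).
exists N => k /hN; rewrite ltr_pdivlMr // -mulmxBl => hk.
apply: le_lt_trans (mnorm1M _ _) _; apply: le_lt_trans hk.
by rewrite ler_wpM2l ?mnorm1_ge0 // lerDl.
Qed.

Lemma mcvg_le m n (U : nat -> 'M[R[i]]_(m, n)) L B :
  mcvg U L -> (forall k, mnorm1 (U k) <= B) -> mnorm1 L <= B.
Proof.
move=> h hB; apply/ler_addgt0Pr => e e0; have [N hN] := h _ e0.
have := hN N (leqnn _); have := hB N; move: (U N) => V h1 h2.
have -> : L = V + - (V - L) by rewrite opprB addrC subrK.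
by apply: le_trans (mnorm1D _ _) _; rewrite mnorm1N; lra.
Qed.

Lemma mcvgB m n (U : nat -> 'M[R[i]]_(m, n)) L A :
  mcvg U L -> mcvg (fun k => U k - A) (L - A).
Proof.
move=> h e /h[N hN]; exists N => k /hN.
by rewrite opprB addrA subrK.
Qed.

Lemma mcvgM m n p (U : nat -> 'M[R[i]]_(m, n)) (V : nat -> 'M[R[i]]_(n, p)) L M :
  mcvg U L -> mcvg V M -> mcvg (fun k => U k *m V k) (L *m M).
Proof.
move=> hU hV e e0; have l0 : 0 < mnorm1 L + 1 by rewrite ltr_wpDl ?mnorm1_ge0.
have m0 : 0 < mnorm1 M + 1 by rewrite ltr_wpDl ?mnorm1_ge0.
have e1 : 0 < Num.min 1 (e / 2 / (mnorm1 L + 1)).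
  by rewrite lt_min ltr01 !divr_gt0.
have e2 : 0 < e / 2 / (mnorm1 M + 1) by rewrite !divr_gt0.
have [N hN] := hV _ e1; have [N' hN'] := hU _ e2.
exists (maxn N N') => k hk.
have := hN k (leq_trans (leq_maxl _ _) hk); rewrite lt_min => /andP[v1].
have := hN' k (leq_trans (leq_maxr _ _) hk).
rewrite !ltr_pdivlMr //; move: (U k) (V k) v1 => u v v1 hu hv.
have -> : u *m v - L *m M = (u - L) *m M + (u - L) *m (v - M) + L *m (v - M).
  by rewrite !mulmxBl !mulmxBr; apply/matrixP => i j; rewrite !mxE; ring.
apply: le_lt_trans (mnorm1D _ _) _.
apply: le_lt_trans (lerD (mnorm1D _ _) (mnorm1M _ _)) _.
apply: le_lt_trans (lerD (lerD (mnorm1M _ _) (mnorm1M _ _)) (lexx _)) _.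
have := mnorm1_ge0 (u - L); have := mnorm1_ge0 (v - M).
have := mnorm1_ge0 L; have := mnorm1_ge0 M.
move: (mnorm1 _) (mnorm1 _) (mnorm1 _) (mnorm1 _) v1 hu hv => a b c d *.
by nra.
Qed.

End MatrixNorm.

Section MatrixExponential.
Context {R : realType}.

(** The sum of the first [n] terms of the exponential series of [X]. *)
Definition expsum m (X : 'M[R[i]]_m) (n : nat) : 'M[R[i]]_m :=
  \sum_(k < n) (k`!%:R^-1) *: (X ^+ k).

Lemma cnorm1_invfact k : cnorm1 (k`!%:R^-1 : R[i]) = k`!%:R^-1.
Proof.
have -> : (k`!%:R^-1 : R[i]) = (k`!%:R^-1)%:C by rewrite fmorphV rmorph_nat.
by rewrite cnorm1_real ger0_norm // invr_ge0.
Qed.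

Lemma mnorm1_expterm m (X : 'M[R[i]]_m) k :
  mnorm1 ((k`!%:R^-1) *: (X ^+ k)) <=
    mnorm1 (1%:M : 'M[R[i]]_m) * exp_coeff (mnorm1 X) k.
Proof.
apply: le_trans (mnorm1Z _ _) _; rewrite cnorm1_invfact exp_coeffE mulrCA.
by apply: ler_wpM2l (mnorm1X _ _); rewrite invr_ge0.
Qed.

Lemma is_cvg_dominated (u : nat -> R) (C x : R) :
  (forall k, `|u k| <= C * exp_coeff x k) -> cvgn (series u).
Proof.
move=> h; apply: normed_cvg.
apply: (@series_le_cvg _ _ (fun k => C * exp_coeff x k)) => //.
- by move=> n /=.
- by move=> n; apply: le_trans (h n); rewrite normr_ge0.
- by apply: is_cvg_seriesZ; apply: is_cvg_series_exp_coeff.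
Qed.

Lemma Re_expsum m (X : 'M[R[i]]_m) i j :
  (fun n => complex.Re (expsum X n i j)) =
  series (fun k => complex.Re (((k`!%:R^-1) *: (X ^+ k)) i j)).
Proof.
by apply/funext => n; rewrite /expsum summxE Re_sum /series /= big_mkord.
Qed.

Lemma Im_expsum m (X : 'M[R[i]]_m) i j :
  (fun n => complex.Im (expsum X n i j)) =
  series (fun k => complex.Im (((k`!%:R^-1) *: (X ^+ k)) i j)).
Proof.
by apply/funext => n; rewrite /expsum summxE Im_sum /series /= big_mkord.
Qed.

Lemma expsum_entry_cvg m (X : 'M[R[i]]_m) i j :
  cvgn (fun n => complex.Re (expsum X n i j)) /\
  cvgn (fun n => complex.Im (expsum X n i j)).
Proof.
have h k : cnorm1 (((k`!%:R^-1) *: (X ^+ k)) i j) <=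
    mnorm1 (1%:M : 'M[R[i]]_m) * exp_coeff (mnorm1 X) k.
  exact: le_trans (mnorm1_entry _ _ _) (mnorm1_expterm _ _).
rewrite Re_expsum Im_expsum; split; apply: is_cvg_dominated => k.
  by apply: le_trans (h k); rewrite /cnorm1 lerDl.
by apply: le_trans (h k); rewrite /cnorm1 lerDr.
Qed.

Lemma cvg_common_rank (I : finType) (u : I -> nat -> R) :
  (forall i, u i @ \oo --> 0) -> forall e : R, 0 < e ->
  exists N, forall i k, (N <= k)%N -> `|u i k| < e.
Proof.
move=> h e e0.
have h1 i : exists N, forall k, (N <= k)%N -> `|u i k| < e.
  have /cvgrPdist_lt /(_ _ e0)[N _ hN] := h i.
  by exists N => k hk; rewrite -[u i k]opprK normrN -sub0r; apply: hN.
have [N hN] := boolp.choice h1.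
exists (\max_i N i) => i k hk; apply: hN; apply: leq_trans hk.
exact: leq_bigmax.
Qed.

(** [mexp] is defined entrywise, with limits that have a default value when the
    sequence diverges; this says that its value is the actual sum. *)
Lemma expsum_cvg m (X : 'M[R[i]]_m) : mcvg (expsum X) (mexp X).
Proof.
pose u (p : 'I_m * 'I_m) n := cnorm1 ((expsum X n - mexp X) p.1 p.2).
have hu p : u p @ \oo --> 0.
  have [hR hI] := expsum_entry_cvg X p.1 p.2.
  have -> : u p = fun n =>
     `|complex.Re (expsum X n p.1 p.2) - limn (fun n => complex.Re (expsum X n p.1 p.2))|
   + `|complex.Im (expsum X n p.1 p.2) - limn (fun n => complex.Im (expsum X n p.1 p.2))|.
    apply/funext => n; rewrite /u /mexp /limC !mxE /cnorm1.
    by case: (expsum X n p.1 p.2).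
  rewrite -[0]addr0; apply: cvgD.
    by apply/norm_cvg0P; apply/subr_cvg0.
  by apply/norm_cvg0P; apply/subr_cvg0.
move=> e e0; pose c : R := (#|{: 'I_m * 'I_m}|.+1)%:R.
have c0 : 0 < c by rewrite ltr0n.
have [N hN] := cvg_common_rank hu (divr_gt0 e0 c0).
exists N => k hk; rewrite /mnorm1 pair_big /=.
apply: (@le_lt_trans _ _ (\sum_(p : 'I_m * 'I_m) e / c)).
  apply: ler_sum => p _; apply: ltW.
  by have := hN p k hk; rewrite /u ger0_norm ?cnorm1_ge0.
rewrite sumr_const -mulr_natr mulrAC ltr_pdivrMr // ltr_pM2l //.
by rewrite ltr_nat.
Qed.

Lemma expsum_comm m n (A : 'M[R[i]]_(m, n)) X Y k :
  A *m X = Y *m A -> A *m expsum X k = expsum Y k *m A.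
Proof.
move=> h; rewrite /expsum mulmx_sumr mulmx_suml; apply: eq_bigr => i _.
rewrite -scalemxAr -scalemxAl; congr (_ *: _).
elim: (i : nat) => [|l IH]; first by rewrite !expr0 mulmx1 mul1mx.
have -> : X ^+ l.+1 = X ^+ l *m X by rewrite exprSr.
have -> : Y ^+ l.+1 = Y ^+ l *m Y by rewrite exprSr.
by rewrite mulmxA IH -(mulmxA (Y ^+ l) A X) h mulmxA.
Qed.

Lemma mexp_comm m (A X : 'M[R[i]]_m) :
  A *m X = X *m A -> A *m mexp X = mexp X *m A.
Proof.
move=> h; apply: (mcvg_unique (U := fun k => A *m expsum X k)).
  exact/mcvgMl/expsum_cvg.
have -> : (fun k => A *m expsum X k) = (fun k => expsum X k *m A).
  by apply/funext => k; apply: expsum_comm.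
exact/mcvgMr/expsum_cvg.
Qed.

End MatrixExponential.

Section ExponentialInverse.
Context {R : realType}.

(** The partial sum, of degree less than [n], of the power series of exp (c x). *)
Definition exp_poly (c : R[i]) n : {poly R[i]} :=
  \poly_(k < n) (c ^+ k / k`!%:R).

Lemma coef_exp_poly c n k :
  (exp_poly c n)`_k = if (k < n)%N then c ^+ k / k`!%:R else 0.
Proof. exact: coef_poly. Qed.

Lemma binomial_coef_sum (c : R[i]) m :
  \sum_(j < m.+1) (1 ^+ j / j`!%:R) * (c ^+ (m - j) / (m - j)`!%:R) =
    (1 + c) ^+ m / m`!%:R.
Proof.
have nz k : k`!%:R != 0 :> R[i] by rewrite pnatr_eq0 -lt0n fact_gt0.
rewrite addrC exprDn mulr_suml; apply: eq_bigr => j _.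
have jm : (j <= m)%N by rewrite -ltnS.
rewrite -(bin_fact jm) !natrM -mulr_natr expr1n.
have := nz j; have := nz (m - j)%N; have : 'C(m, j)%:R != 0 :> R[i].
  by rewrite pnatr_eq0 -lt0n bin_gt0.
by move=> *; field; apply/and3P; split.
Qed.

(** The product of the truncations of exp x and exp (- x) agrees with 1
    below degree [n], and its coefficients are dominated by those of exp (2 x). *)
Lemma exp_poly_coef_low n k : (k < n)%N ->
  (exp_poly 1 n * exp_poly (-1) n)`_k = (k == 0%N)%:R.
Proof.
move=> kn; rewrite coefM (eq_bigr (fun j : 'I_k.+1 =>
    (1 ^+ j / j`!%:R) * ((-1) ^+ (k - j) / (k - j)`!%:R))) => [|j _].
  rewrite binomial_coef_sum subrr expr0n.
  by case: eqP => [->|_]; rewrite ?mul0r // fact0 divr1.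
have jk : (j <= k)%N by rewrite -ltnS.
congr (_ * _); rewrite coef_exp_poly ?(leq_ltn_trans jk kn) //.
by rewrite (leq_ltn_trans (leq_subr _ _) kn).
Qed.

Lemma exp_poly_coef_bound n k :
  cnorm1 (exp_poly 1 n * exp_poly (-1) n)`_k <= exp_coeff 2 k.
Proof.
have h0 j : cnorm1 (exp_poly 1 n)`_j <= j`!%:R^-1.
  rewrite coef_exp_poly; case: ifP => _; last by rewrite cnorm10 invr_ge0.
  by rewrite expr1n mul1r cnorm1_invfact.
have h1 j : cnorm1 (exp_poly (-1) n)`_j <= j`!%:R^-1.
  rewrite coef_exp_poly; case: ifP => _; last by rewrite cnorm10 invr_ge0.
  rewrite -signr_odd -cnorm1_invfact; case: odd.
    by rewrite expr1 mulN1r cnorm1N.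
  by rewrite expr0 mul1r.
rewrite coefM; apply: le_trans (cnorm1_sum _ _ _) _.
apply: (@le_trans _ _ (\sum_(j < k.+1) j`!%:R^-1 * (k - j)`!%:R^-1)).
  apply: ler_sum => j _; apply: le_trans (cnorm1M _ _) _.
  by apply: ler_pM (cnorm1_ge0 _) (cnorm1_ge0 _) (h0 _) (h1 _).
rewrite exp_coeffE -[2%R]/(1 + 1) exprDn mulrC mulr_suml; apply: ler_sum => j _.
have nz i : i`!%:R != 0 :> R by rewrite pnatr_eq0 -lt0n fact_gt0.
have jm : (j <= k)%N by rewrite -ltnS.
rewrite -(bin_fact jm) !natrM -mulr_natr !expr1n !mul1r.
have := nz j; have := nz (k - j)%N; have : 'C(k, j)%:R != 0 :> R.
  by rewrite pnatr_eq0 -lt0n bin_gt0.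
by move=> *; rewrite le_eqVlt; apply/orP; left; apply/eqP; field; apply/and3P; split.
Qed.

Lemma horner_mx_poly m (X : 'M[R[i]]_m.+1) n (c : nat -> R[i]) :
  horner_mx X (\poly_(k < n) c k) = \sum_(k < n) c k *: X ^+ k.
Proof.
rewrite poly_def rmorph_sum; apply: eq_bigr => k _ /=.
by rewrite horner_mxZ rmorphXn /= horner_mx_X.
Qed.

Lemma expsum_horner m (X : 'M[R[i]]_m.+1) n (s : bool) :
  expsum ((-1) ^+ s *: X) n = horner_mx X (exp_poly ((-1) ^+ s) n).
Proof.
rewrite horner_mx_poly; apply: eq_bigr => k _.
by rewrite exprZn scalerA mulrC.
Qed.

Lemma expsumN_bound m (X : 'M[R[i]]_m.+1) n : (0 < n)%N ->
  mnorm1 (expsum X n *m expsum (- X) n - 1%:M) <=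
    mnorm1 (1%:M : 'M[R[i]]_m.+1) *
    \sum_(n <= k < n + n) exp_coeff (2 * mnorm1 X) k.
Proof.
move=> n0.
rewrite -[X in expsum X n](scale1r X) -(scaleN1r X).
rewrite -(expr0 (-1)) -{3}(expr1 (-1)) (expsum_horner X n false).
rewrite (expsum_horner X n true) -[_ *m _]rmorphM /=.
set p := (_ * _).
have sp : (size p <= n + n)%N.
  apply: leq_trans (size_polyMleq _ _) _.
  by apply: leq_trans (leq_pred _) (leq_add (size_poly _ _) (size_poly _ _)).
have -> : p = \poly_(k < n + n) p`_k.
  by apply/polyP => k; rewrite coef_poly; case: ltnP => // h;
    rewrite nth_default ?(leq_trans sp).
rewrite horner_mx_poly -(big_mkord xpredT (fun k => p`_k *: X ^+ k)).
rewrite (big_cat_nat (n := n)) ?leq_addr //=.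
(* the terms of index below n add up to the identity matrix *)
rewrite (big_ltn n0) exp_poly_coef_low // eqxx scale1r expr0.
rewrite big_nat big1 => [|k /andP[k0 kn]]; last first.
  by rewrite exp_poly_coef_low // eqn0Ngt k0 scale0r.
rewrite addr0 addrC addrK; apply: le_trans (mnorm1_sum _ _ _) _.
rewrite mulr_sumr; apply: ler_sum => k _.
apply: le_trans (mnorm1Z _ _) _.
apply: le_trans (ler_pM (cnorm1_ge0 _) (mnorm1_ge0 _) (exp_poly_coef_bound n k) (mnorm1X _ _)) _.
by rewrite !exp_coeffE exprMn le_eqVlt; apply/orP; left; apply/eqP; ring.
Qed.

Lemma exp_tail_cvg (x e : R) : 0 < e -> exists N, forall n, (N <= n)%N ->
  `|\sum_(n <= k < n + n) exp_coeff x k| < e.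
Proof.
move=> e0; have /cvgrPdist_lt hc := is_cvg_series_exp_coeff x.
have [N _ hN] := hc _ (divr_gt0 e0 (ltr0n R 2)).
exists N => n hn; have h1 := hN n hn.
have h2 : `|limn (series (exp_coeff x)) - series (exp_coeff x) (n + n)| < e / 2.
  by apply: hN => /=; apply: leq_trans hn _; rewrite leq_addr.
have -> : \sum_(n <= k < n + n) exp_coeff x k =
    series (exp_coeff x) (n + n) - series (exp_coeff x) n.
  by rewrite sub_series_geq ?leq_addr.
move: (series _ _) (series _ _) (limn _) h1 h2 => a b c.
rewrite !ltr_norml => /andP[? ?] /andP[? ?]; apply/andP; split; lra.
Qed.

Lemma mexpN m (X : 'M[R[i]]_m) : mexp X *m mexp (- X) = 1%:M.
Proof.
case: m X => [|m] X; first by apply/matrixP => -[].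
apply: (mcvg_unique (mcvgM (expsum_cvg X) (expsum_cvg (- X)))) => e e0.
have K0 : 0 < mnorm1 (1%:M : 'M[R[i]]_m.+1) + 1 by rewrite ltr_wpDl ?mnorm1_ge0.
have [N hN] := exp_tail_cvg (2 * mnorm1 X) (divr_gt0 e0 K0).
exists (maxn N 1) => k hk; apply: le_lt_trans (expsumN_bound _ _) _.
  exact: leq_trans (leq_maxr _ _) hk.
have := hN k (leq_trans (leq_maxl _ _) hk); rewrite ltr_pdivlMr // => h.
apply: le_lt_trans h.
rewrite mulrC; apply: ler_pM; rewrite ?mnorm1_ge0 ?lerDl ?ler_norm //.
apply: sumr_ge0 => i _; apply: exp_coeff_ge0.
by rewrite mulr_ge0 ?mnorm1_ge0.
Qed.

(** The invertibility of [mexp X] makes the elements of the analytic subgroups,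
    and the values of [rho] on P, invertible. *)
Lemma mexp_unit m (X : 'M[R[i]]_m) : mexp X \in unitmx.
Proof. exact: proj1 (mulmx1_unit (mexpN X)). Qed.

Lemma exprZmx m a (X : 'M[R[i]]_m) k : (a *: X) ^+ k = a ^+ k *: X ^+ k.
Proof.
elim: k => [|k IH]; first by rewrite !expr0 scale1r.
rewrite !exprS IH -[LHS]/((a *: X) *m (a ^+ k *: X ^+ k)).
by rewrite -scalemxAl -scalemxAr scalerA.
Qed.

Lemma mexp_taylor1 m (X : 'M[R[i]]_m) : exists C : R, forall t : R,
  0 < t <= 1 -> mnorm1 (mexp (t%:C *: X) - 1%:M - t%:C *: X) <= t ^+ 2 * C.
Proof.
pose K := mnorm1 (1%:M : 'M[R[i]]_m).
pose b := exp_coeff (mnorm1 X).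
exists (K * limn (series b)) => t /andP[t0 t1].
have t0' := ltW t0.
have b0 k : 0 <= b k by apply: exp_coeff_ge0; apply: mnorm1_ge0.
apply: (@mcvg_le _ _ _ (fun n => expsum (t%:C *: X) n.+2 - 1%:M - t%:C *: X)).
  apply/mcvgB/mcvgB => e /(expsum_cvg (t%:C *: X))[N hN].
  by exists N => k hk; apply: hN; apply: leq_trans hk _; rewrite -addn2 leq_addr.
move=> n; rewrite /expsum 2!big_ord_recl /= fact0 invr1 scale1r expr0.
rewrite scale1r [X in _ + (X + _)]expr1 -[1%:M]/(1 : 'M[R[i]]_m) [1 + _]addrC.
rewrite addrK.
rewrite [t%:C *: X + _]addrC addrK.
apply: le_trans (mnorm1_sum _ _ _) _.
apply: (@le_trans _ _ (\sum_(i < n) t ^+ 2 * (K * b i.+2))).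
  apply: ler_sum => i _; rewrite /bump /= !add1n exprZmx scalerA.
  have := mnorm1_expterm X i.+2; rewrite -/K -/b => h.
  rewrite mulrC -scalerA; apply: le_trans (mnorm1Z _ _) _.
  rewrite -rmorphXn cnorm1_real normrX ger0_norm //.
  apply: ler_pM => //; rewrite ?exprn_ge0 ?mnorm1_ge0 //.
  by rewrite exprSr exprSr -mulrA -expr2 ler_piMl ?sqr_ge0 // exprn_ile1.
rewrite -mulr_sumr -mulr_sumr ler_wpM2l ?sqr_ge0 // ler_wpM2l ?mnorm1_ge0 //.
have hc : cvgn (series b) by apply: is_cvg_series_exp_coeff.
apply: le_trans (nondecreasing_cvgn_le _ hc n.+2); last first.
  by apply: nondecreasing_series => k _ _; apply: b0.
by rewrite /series /= big_mkord 2!big_ord_recl /= addrA lerDr addr_ge0.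
Qed.

(** Differentiating at t = 0 the relation A exp (t X) = exp (t X) A. *)
Lemma mexp_comm_inv m (A X : 'M[R[i]]_m) :
  (forall t : R, A *m mexp (t%:C *: X) = mexp (t%:C *: X) *m A) ->
  A *m X = X *m A.
Proof.
move=> h; have [C hC] := mexp_taylor1 X.
apply/eqP; rewrite -subr_eq0; apply/eqP/mnorm1_eq0/eqP.
rewrite eq_le mnorm1_ge0 andbT.
pose a := mnorm1 A.
have a0 : 0 <= a := mnorm1_ge0 _.
have key t : 0 < t <= 1 -> mnorm1 (A *m X - X *m A) <= t * (2 * a * C).
  move=> /[dup] /hC hr /andP[t0 t1].
  have [r e {}hr] : exists2 r, mexp (t%:C *: X) = r + t%:C *: X + 1%:M &
      mnorm1 r <= t ^+ 2 * C.
    by exists (mexp (t%:C *: X) - 1%:M - t%:C *: X); rewrite ?subrK.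
  have := h t; rewrite e !mulmxDr !mulmxDl mulmx1 mul1mx => /addIr.
  rewrite -scalemxAr -scalemxAl => e1.
  have e2 : t%:C *: (A *m X - X *m A) = r *m A - A *m r.
    rewrite scalerBr; apply/eqP; rewrite subr_eq addrAC eq_sym subr_eq.
    by rewrite -e1 addrC eqxx.
  have t0n : t != 0 by rewrite gt_eqF.
  have -> : A *m X - X *m A = (t^-1)%:C *: (r *m A - A *m r).
    by rewrite -e2 scalerA -rmorphM mulVf // rmorph1 scale1r.
  apply: le_trans (mnorm1Z _ _) _.
  rewrite cnorm1_real ger0_norm ?invr_ge0 ?(ltW t0) // ler_pdivrMl //.
  apply: le_trans (mnorm1D _ _) _; rewrite mnorm1N.
  apply: le_trans (lerD (mnorm1M _ _) (mnorm1M _ _)) _; rewrite -/a.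
  have := mnorm1_ge0 r; move: (mnorm1 r) hr => y hr y0.
  have := ler_wpM2l a0 hr; lra.
have C0 : 0 <= C.
  have := hC 1; rewrite expr1n mul1r ltr01 lexx => /(_ isT).
  exact/le_trans/mnorm1_ge0.
apply/ler_addgt0Pr => e e0; rewrite add0r.
pose M := 2 * a * C + 1.
have M0 : 0 < M by rewrite ltr_wpDl // !mulr_ge0.
have t0 : 0 < Num.min 1 (e / M) by rewrite lt_min ltr01 divr_gt0.
apply: (le_trans (key (Num.min 1 (e / M)) _)).
  by rewrite t0 ge_min lexx.
have : Num.min 1 (e / M) <= e / M by rewrite ge_min lexx orbT.
rewrite ler_pdivlMr // => h1; apply: le_trans h1.
by rewrite ler_wpM2l ?(ltW t0) // lerDl.
Qed.

End ExponentialInverse.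

(** * Weight decompositions and sl2-modules *)

Section WeightSums.
Context {F : fieldType} {V : vectType F}.

(** Linear subspaces as predicates. *)
Definition sub_closed (S : V -> Prop) : Prop :=
  S 0 /\ forall c x y, S x -> S y -> S (c *: x + y).

Lemma sub_closed_sum (S : V -> Prop) I (r : seq I) (p : pred I) (f : I -> V) :
  sub_closed S -> (forall i, p i -> S (f i)) -> S (\sum_(i <- r | p i) f i).
Proof.
move=> [S0 SL] h; elim/big_rec: _ => // i x pi Sx.
by rewrite -[f i]scale1r; apply: SL => //; apply: h.
Qed.

Lemma sub_closedZ (S : V -> Prop) c x : sub_closed S -> S x -> S (c *: x).
Proof. by move=> [S0 SL] Sx; rewrite -[c *: x]addr0; apply: SL. Qed.

Lemma sub_closedD (S : V -> Prop) x y : sub_closed S -> S x -> S y -> S (x + y).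
Proof. by move=> [S0 SL] Sx Sy; rewrite -[x]scale1r; apply: SL. Qed.

Lemma sub_closed_vspace (U : {vspace V}) : sub_closed (fun x => x \in U).
Proof. by split=> [|c x y hx hy]; rewrite ?mem0v // rpredD // rpredZ. Qed.

(** In finite dimension every subspace is a detachable one: take a detachable
    subspace of maximal dimension contained in [S]. *)
Lemma vspace_of_sub_closed (S : V -> Prop) : sub_closed S ->
  exists U : {vspace V}, forall x, x \in U <-> S x.
Proof.
move=> SP; have [S0 SL] := SP.
pose p n := `[< exists U : {vspace V}, \dim U = n /\ forall x, x \in U -> S x >].
have p0 : exists n, p n.
  exists 0%N; apply/asboolP; exists 0%VS; split; first by rewrite dimv0.
  by move=> x; rewrite memv0 => /eqP->.
have pb n : p n -> (n <= \dim {:V})%N.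
  by move=> /asboolP[U [<- _]]; apply/dimvS/subvf.
case: (ex_maxnP p0 pb) => n /asboolP[U [dU US]] nmax.
exists U => x; split=> [/US//|Sx].
have h : (\dim (U + <[x]>) <= \dim U)%N.
  rewrite dU; apply: nmax; apply/asboolP; exists (U + <[x]>)%VS; split=> //.
  move=> y /memv_addP[u uU [w /vlineP[c ->] ->]].
  by rewrite addrC; apply: SL => //; apply: US.
have : (U == U + <[x]>)%VS by rewrite eqEdim addvSl h.
move=> /eqP ->; apply: subvP (addvSr _ _) _ _; exact: memv_line.
Qed.

Context {W : eqType} (Wd : W -> V -> Prop).

(** Sums of vectors of distinct weights, [Wd a] being the space of vectors of
    weight [a]. *)
Definition wsum (x : V) : Prop := exists (s : seq W) (y : W -> V),
  [/\ uniq s, forall a, a \in s -> Wd a (y a) & x = \sum_(a <- s) y a].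

Hypothesis Wd_closed : forall a, sub_closed (Wd a).

Lemma wsum0 : wsum 0.
Proof. by exists [::], (fun=> 0); split; rewrite ?big_nil. Qed.

Lemma wsum_add a z x : Wd a z -> wsum x -> wsum (z + x).
Proof.
move=> hz [s [y [us hy ->]]]; pose y' b := if b == a then z + y b else y b.
have [ha|ha] := boolP (a \in s).
  exists s, y'; split=> //.
    move=> b hb; rewrite /y'; case: eqP => [e|_]; last exact: hy.
    by rewrite e in hb *; apply: sub_closedD => //; apply: hy.
  rewrite !(bigD1_seq a) //= {1}/y' eqxx addrA; congr (_ + _).
  by apply: eq_bigr => b /negbTE; rewrite /y' => ->.
exists (a :: s), (fun b => if b == a then z else y b); split; first by rewrite /= ha.
  move=> b; rewrite inE; case: eqP => [->//|_] /=; exact: hy.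
rewrite big_cons eqxx; congr (_ + _); apply: eq_big_seq => b hb.
by case: eqP => // e; rewrite -e hb in ha.
Qed.

Lemma wsum_closed : sub_closed wsum.
Proof.
split; first exact: wsum0.
move=> c _ x' [s [y [us hy ->]]] hx'; rewrite scaler_sumr.
elim: s us hy => [_ _|a s IH /= /andP[_ us] hy]; first by rewrite big_nil add0r.
rewrite big_cons -addrA; apply: wsum_add; last first.
  by apply: IH => // b hb; apply: hy; rewrite inE hb orbT.
by apply: sub_closedZ => //; apply: hy; rewrite inE eqxx.
Qed.

Lemma wsum_in a z : Wd a z -> wsum z.
Proof. by move=> hz; rewrite -[z]addr0; apply: wsum_add hz wsum0. Qed.

Context {T : Type} (op : T -> V -> V) (ev : W -> T -> F).
Hypothesis op_lin : forall H, linear (op H).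
Hypothesis ev_inj : forall a b, (forall H, ev a H = ev b H) -> a = b.

Lemma op_sum H (s : seq W) (y : W -> V) :
  op H (\sum_(a <- s) y a) = \sum_(a <- s) op H (y a).
Proof.
have op0 : op H 0 = 0.
  by have := op_lin H (-1) 0 0; rewrite !scaleN1r oppr0 addr0 addNr.
elim: s => [|a s IH]; first by rewrite !big_nil.
by rewrite !big_cons -[y a]scale1r op_lin IH !scale1r.
Qed.

(** A subspace stable under a family of operators contains the components, for
    distinct weights, of each of its elements. *)
Lemma weight_components (S : V -> Prop) : sub_closed S ->
  (forall H x, S x -> S (op H x)) ->
  forall (s : seq W) (y : W -> V), uniq s ->
  (forall a, a \in s -> forall H, op H (y a) = ev a H *: y a) ->
  S (\sum_(a <- s) y a) -> forall a, a \in s -> S (y a).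
Proof.
move=> SP Sop; elim=> [//|b s IH] y /= /andP[bs us] hy hS.
have {}IH a : a \in s -> S (y a).
  move=> ha; have ab : a <> b by move=> e; rewrite -e ha in bs.
  have [H hH] : exists H, ev a H <> ev b H.
    apply: contrapT => hn; apply: ab; apply: ev_inj => H.
    by apply: contrapT => e; apply: hn; exists H.
  have d0 : ev a H - ev b H != 0 by rewrite subr_eq0; apply/eqP.
  rewrite -[y a]scale1r -(mulVf d0) -scalerA; apply: sub_closedZ => //.
  apply: (IH (fun a => (ev a H - ev b H) *: y a)) => //.
    move=> c hc K; have := op_lin K (ev c H - ev b H) (y c) 0.
    have -> : op K 0 = 0.
      by have := op_sum K [::] y; rewrite !big_nil.
    rewrite !addr0 => ->; rewrite hy ?inE ?hc ?orbT //.
    by rewrite !scalerA mulrC.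
  (* applying op H - ev b H kills the component of weight b *)
  have -> : \sum_(a <- s) (ev a H - ev b H) *: y a =
      - ev b H *: (\sum_(a <- b :: s) y a) + op H (\sum_(a <- b :: s) y a).
    rewrite op_sum !big_cons hy ?inE ?eqxx // scalerDr addrACA scaleNr addNr add0r.
    rewrite scaler_sumr -big_split; apply: eq_big_seq => c hc /=.
    by rewrite hy ?inE ?hc ?orbT // scalerBl scaleNr addrC.
  by apply: (proj2 SP) => //; apply: Sop.
move=> a; rewrite inE => /orP[/eqP->|]; last exact: IH.
rewrite big_cons in hS.
have -> : y b = -1 *: (\sum_(j <- s) y j) + (y b + \sum_(j <- s) y j).
  by rewrite scaleN1r addrC addrK.
apply: (proj2 SP) => //; elim: s {us hS bs hy} IH => [|c s IHs] h.
  by rewrite big_nil; case: SP.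
rewrite big_cons; apply: sub_closedD => //; first by apply: h; rewrite inE eqxx.
by apply: IHs => d hd; apply: h; rewrite inE hd orbT.
Qed.

End WeightSums.

Section SL2.
Context {F : fieldType} {V : lmodType F} (e f h : {linear V -> V}).
Hypothesis ef : forall x, e (f x) - f (e x) = h x.
Hypothesis hf : forall x, h (f x) - f (h x) = - 2 *: f x.

Lemma sl2_h_iter nu w j : h w = nu *: w ->
  h (iter j f w) = (nu - 2 * j%:R) *: iter j f w.
Proof.
move=> hw; elim: j => [|j IH] /=; first by rewrite mulr0 subr0.
have /eqP := hf (iter j f w); rewrite subr_eq IH linearZ -scalerDl => /eqP->.
by congr (_ *: _); rewrite -natr1; ring.
Qed.

Lemma sl2_e_iter nu w j : e w = 0 -> h w = nu *: w ->
  e (iter j.+1 f w) = (j.+1%:R * (nu - j%:R)) *: iter j f w.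
Proof.
move=> ew hw; elim: j => [|j IH].
  by have /eqP := ef w; rewrite ew linear0 subr0 hw => /eqP->; rewrite mul1r subr0.
have /eqP := ef (iter j.+1 f w); rewrite subr_eq (sl2_h_iter _ hw) IH linearZ.
rewrite -iterS -scalerDl => /eqP->.
by congr (_ *: _); rewrite -!natr1; ring.
Qed.

Lemma sl2_e_iter_iter nu w k : e w = 0 -> h w = nu *: w ->
  iter k e (iter k f w) = (\prod_(j < k) (j.+1%:R * (nu - j%:R))) *: w.
Proof.
move=> ew hw; elim: k => [|k IH]; first by rewrite big_ord0 scale1r.
rewrite iterSr (sl2_e_iter _ ew hw) big_ord_recr /= [in RHS]mulrC -[RHS]scalerA -IH.
elim: {IH}k (iter k f w) (_ * _) => // k IHk x c; rewrite !iterS IHk.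
by rewrite linearZ.
Qed.

End SL2.

(** * Positivity of the Cartan matrices of type ADE *)

Section DynkinPositivity.

(** A sum over indices with a property is bounded by the sum over a list that
    contains all of them. *)
Lemma sum_cover_le (l : nat) (d : nat -> nat) (s : seq nat) (P : pred nat) :
  (forall i, (i < l)%N -> P i -> i \in s) ->
  (\sum_(i < l | P i) d i <= \sum_(k <- s) d k)%N.
Proof.
elim: s P => [|k s IH] P h.
  by rewrite big_nil leqn0; apply/eqP; apply: big1 => i Pi; have := h i (ltn_ord i) Pi.
rewrite big_cons (bigID (fun i : 'I_l => (i : nat) == k)) /=; apply: leq_add; last first.
  apply: (IH (fun i => P i && (i != k))) => i il /andP[Pi ik].
  by have := h i il Pi; rewrite inE (negbTE ik).
have [kl|kl] := ltnP k l; last first.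
  rewrite big1 // => i /andP[_ /eqP ik].
  by have := ltn_ord i; rewrite ik ltnNge kl.
apply: leq_trans (_ : \sum_(i < l | (i : nat) == k) d i <= _)%N.
  by rewrite big_mkcondl; apply: leq_sum => i _; case: (P i).
by rewrite (big_pred1 (Ordinal kl)) // => i; rewrite -val_eqE.
Qed.

(** Twice the label of a node exceeds the sum of the labels of its neighbours, for
    the labelling by the coefficients of the sum of the positive coroots (doubled
    in type D). *)
Lemma dynkin_subadditive t l : ade_rank t l -> exists d : nat -> nat,
  forall j, (j < l)%N -> exists2 s : seq nat,
    (forall i, (i < l)%N -> dynkin_edge t l i j -> i \in s) &
    (\sum_(k <- s) d k < 2 * d j)%N.
Proof.
case: t => /= hl.
- exists (fun k => k.+1 * (l - k))%N => j jl.
  exists (if j is j'.+1 then [:: j'; j'.+2] else [:: 1%N]).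
    move=> i il; rewrite /chain_edge => /orP[/eqP e|/eqP e].
      by rewrite -e !inE eqxx.
    by rewrite -e; case: (j) => [|j']; rewrite !inE eqxx ?orbT.
  case: j jl => [|j] jl; rewrite !big_cons big_nil; first by nia.
  have [k ->] : exists k, l = (j + k.+2)%N by exists (l - j.+2)%N; lia.
  have -> : (j + k.+2 - j = k.+2)%N by lia.
  have -> : (j + k.+2 - j.+1 = k.+1)%N by lia.
  have -> : (j + k.+2 - j.+2 = k)%N by lia.
  by nia.
- pose d k := (if (k < l - 2)%N then 2 * k.+1 * (2 * l - k - 2) else l * (l - 1))%N.
  have dlo x : (x < l - 2)%N -> d x = (2 * x.+1 * (2 * l - x - 2))%N.
    by rewrite /d => ->.
  have dhi x : (l - 2 <= x)%N -> d x = (l * (l - 1))%N.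
    by rewrite /d ltnNge => ->.
  exists d => j jl.
  have [k lk] : exists k, l = k.+4 by exists (l - 4)%N; lia.
  exists (if j == l.-1 then [:: l - 3]%N else if j == (l - 2)%N then [:: l - 3]%N
     else if j == (l - 3)%N then [:: l - 4; l - 2; l - 1]%N
     else if j is j'.+1 then [:: j'; j'.+2] else [:: 1%N]).
    move=> i il; rewrite /branch_edge /chain_edge; subst l.
    case: (eqVneq i k.+4.-1) => [->|i1].
      move=> /eqP ->; case: (eqVneq _ k.+4.-1) => [|_]; first by lia.
      case: (eqVneq _ (k.+4 - 2)%N) => [|_]; first by lia.
      by rewrite eqxx !inE; lia.
    case: (eqVneq j k.+4.-1) => [_|j1]; first by move=> /eqP ->; rewrite !inE eqxx.
    move=> e; case: (eqVneq j (k.+4 - 2)%N) => [j2|j2]; first by rewrite !inE; lia.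
    case: (eqVneq j (k.+4 - 3)%N) => [j3|j3]; first by rewrite !inE; lia.
    by case: j jl e j1 j2 j3 => [|j] *; rewrite !inE; lia.
  clearbody d; subst l; case: (eqVneq j k.+4.-1) => [->|j1].
    by rewrite big_cons big_nil addn0 dlo ?dhi; lia.
  case: (eqVneq j (k.+4 - 2)%N) => [->|j2].
    by rewrite big_cons big_nil addn0 dlo ?dhi; lia.
  case: (eqVneq j (k.+4 - 3)%N) => [->|j3].
    by rewrite !big_cons big_nil addn0 (dlo (k.+4 - 4)%N) ?(dlo (k.+4 - 3)%N) ?dhi; lia.
  case: j jl j1 j2 j3 => [|j] jl j1 j2 j3; rewrite !big_cons big_nil addn0.
    by rewrite !dlo; lia.
  by rewrite !dlo; lia.
- pose d k := nth 0%N (if l == 6 then [:: 16; 30; 42; 30; 16; 22]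
     else if l == 7 then [:: 34; 66; 96; 75; 52; 27; 49]
     else [:: 92; 182; 270; 220; 168; 114; 58; 136])%N k.
  exists d => j jl; exists [seq i <- iota 0 l | branch_edge 2 l i j].
    by move=> i il e; rewrite mem_filter e mem_iota.
  have : l \in [:: 6; 7; 8]%N by move: hl; rewrite !inE; lia.
  rewrite !inE => /or3P[] /eqP el; subst l;
  by do 8?[case: j jl => [|j] jl //=]; rewrite ?unlock.
Qed.

(** A nonzero combination of simple roots with natural coefficients is positive
    on some simple coroot: pair it with the labelling above. *)
Lemma cartan_positive_pairing t l (c : 'I_l -> nat) :
  ade_rank t l -> (exists j, c j != 0%N) ->
  exists (i : 'I_l) n, \sum_(j < l) (c j)%:Z * cartan_integer t l i j = n.+1%:Z.
Proof.
move=> /dynkin_subadditive[d hd] [j0 cj0].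
pose v (i : 'I_l) := \sum_(j < l) (c j)%:Z * cartan_integer t l i j.
suff [i vi] : exists i, 0 < v i.
  exists i; rewrite -/(v i); case: (v i) vi => [[|n]|n] // _; by exists n.
apply: contrapT => hn.
have vle i : v i <= 0 by rewrite leNgt; apply/negP => h; apply: hn; exists i.
have dpos (j : 'I_l) : 0 < \sum_(i < l) (d i)%:Z * cartan_integer t l i j.
  have [s hs hlt] := hd j (ltn_ord j).
  have h1 := leq_ltn_trans (sum_cover_le (P := fun i => dynkin_edge t l i j) d hs) hlt.
  rewrite (bigD1 j) //= /cartan_integer eqxx.
  apply: lt_le_trans (_ : (2 * d j)%N%:Z - (\sum_(i < l | dynkin_edge t l i j) d i)%N%:Z <= _).
    by lia.
  rewrite PoszM mulrC lerD2l raddf_sum -sumrN /= big_mkcond [leRHS]big_mkcond /=.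
  apply: ler_sum => i _; rewrite val_eqE; case: (eqVneq i j) => _ /=.
    by case: ifP => _; rewrite ?oppr_le0.
  by case: ifP => _; rewrite ?mulrN1 ?mulr0.
have : \sum_(i < l) (d i)%:Z * v i <= 0.
  by apply: sumr_le0 => i _; apply: mulr_ge0_le0.
apply/negP; rewrite -ltNge /v.
under eq_bigr do rewrite mulr_sumr.
rewrite exchange_big /=.
apply: lt_le_trans (_ : (c j0)%:Z * \sum_(i < l) (d i)%:Z * cartan_integer t l i j0 <= _).
  by rewrite mulr_gt0 // ltz_nat lt0n.
rewrite [leRHS](bigD1 j0) //= mulr_sumr.
under eq_bigr do rewrite mulrCA.
rewrite lerDl; apply: sumr_ge0 => j _.
under eq_bigr do rewrite mulrCA.
by rewrite -mulr_sumr mulr_ge0 // ltW.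
Qed.

End DynkinPositivity.

(** * Root spaces and parabolic subalgebras *)

Section LieBracket.
Context {R : realType} {m : nat}.
Implicit Types X Y Z : 'M[R[i]]_m.

Fact lie_is_linear X : linear (lie X).
Proof.
by move=> c Y Z; rewrite /lie mulmxDr mulmxDl -scalemxAr -scalemxAl scalerBr opprD addrACA.
Qed.
HB.instance Definition _ X :=
  GRing.isLinear.Build R[i] 'M[R[i]]_m 'M[R[i]]_m _ (lie X) (lie_is_linear X).

Lemma lieC X Y : lie X Y = - lie Y X.
Proof. by rewrite /lie opprB. Qed.

Lemma lieNl X Y : lie (- X) Y = - lie X Y.
Proof. by rewrite /lie mulNmx mulmxN opprB opprK addrC. Qed.

Lemma lieZl c X Y : lie (c *: X) Y = c *: lie X Y.
Proof. by rewrite /lie -scalemxAl -scalemxAr scalerBr. Qed.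

Lemma lie_jacobi X Y Z : lie X (lie Y Z) = lie (lie X Y) Z + lie Y (lie X Z).
Proof.
rewrite /lie !(mulmxBl, mulmxBr) !mulmxA !opprB.
move: (X *m Y *m Z) (X *m Z *m Y) (Y *m Z *m X) (Z *m Y *m X) (Y *m X *m Z) (Z *m X *m Y).
by move=> a b c d e f; apply/matrixP => i j; rewrite !mxE; ring.
Qed.

Lemma lspan_closed (S : 'M[R[i]]_m -> Prop) : sub_closed (lspan S).
Proof.
split=> [|c X Y]; first exact: lspan0.
move=> hX hY; elim: hX => [|a X1 X2 hS _ IH]; first by rewrite scaler0 add0r.
by rewrite scalerDr -addrA scalerA; apply: lspanS.
Qed.

Lemma lspan_in (S : 'M[R[i]]_m -> Prop) X : S X -> lspan S X.
Proof. by move=> hX; rewrite -[X]scale1r -[_ *: _]addr0; apply: lspanS => //;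
  apply: lspan0. Qed.

Lemma lspan_sub (S Q : 'M[R[i]]_m -> Prop) : sub_closed Q ->
  (forall X, S X -> Q X) -> forall X, lspan S X -> Q X.
Proof.
by move=> [Q0 QL] h X; elim=> // a Y Z hY _ hZ; apply: QL => //; apply: h.
Qed.

End LieBracket.

Section RootSpaces.
Context {R : realType} {m : nat} (G : adeGroup R m).
Local Notation g := (lieG G).
Local Notation h := (cartan G).
Local Notation weight := 'Hom(subvs_of (cartan G), R[i]^o).
Local Notation D := (@simple_root R m G).
Implicit Types (a b : weight) (X Y : 'M[R[i]]_m).

Let glie : lie_subalgebra g. Proof. by case: (lieG_simple G). Qed.
Let hsub : (h <= g)%VS. Proof. by case: (cartanP G). Qed.

Lemma weight_mulrn a k (H : subvs_of h) : (a *+ k) H = k%:R * a H :> R[i].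
Proof. by rewrite -scaler_nat scale_lfunE. Qed.

Lemma root_vector_closed a : sub_closed (root_vector g a).
Proof.
split; first by split=> [|H]; rewrite ?mem0v // linear0 scaler0.
move=> c X Y [gX hX] [gY hY]; split; first by rewrite rpredD // rpredZ.
by move=> H; rewrite linearP /= hX hY scalerDr !scalerA mulrC.
Qed.

Lemma root_vector_lie a b X Y :
  root_vector g a X -> root_vector g b Y -> root_vector g (a + b) (lie X Y).
Proof.
move=> [gX hX] [gY hY]; split; first exact: glie.
move=> H; rewrite lie_jacobi hX hY add_lfunE scalerDl linearZ /=.
by rewrite lieZl.
Qed.

Lemma cartan_root_vector X : X \in h <-> root_vector g (0 : weight) X.
Proof.
have [_ hab _ hcent] := cartanP G; split=> [hX|[gX hX]].
  split; first exact: subvP hX.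
  by move=> H; rewrite hab ?subvsP // lfunE scale0r.
apply: hcent => // H hH; have := hX (vsproj h H).
by rewrite vsprojK // lfunE scale0r.
Qed.

(** An endomorphism of a finite-dimensional space has finitely many eigenvalues, so
    an arithmetic progression of eigenvectors must end. *)
Lemma eigenvalue_progression (f : {linear 'M[R[i]]_m -> 'M[R[i]]_m}) (nu d : R[i])
    (u : nat -> 'M[R[i]]_m) : d != 0 ->
  (forall k, f (u k) = (nu + d * k%:R) *: u k) -> exists k, u k = 0.
Proof.
move=> d0 hu; apply: contrapT => hn.
have un k : u k != 0 by apply/eqP => e; apply: hn; exists k.
pose N := size (char_poly (lin_mx f)).
pose rs := [seq nu + d * k%:R | k <- iota 0 N].
have rinj : injective (fun k : nat => nu + d * k%:R).
  by move=> k l /addrI /(mulfI d0) /eqP; rewrite eqr_nat => /eqP.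
have := @max_poly_roots _ (char_poly (lin_mx f)) rs.
rewrite size_map size_iota ltnn => H; suff : false by [].
apply: H; last by rewrite map_inj_uniq ?iota_uniq.
  by rewrite monic_neq0 ?char_poly_monic.
apply/allP => _ /mapP[k _ ->]; rewrite -eigenvalue_root_char.
apply/eigenvalueP; exists (mxvec (u k)); first by rewrite mul_vec_lin hu linearZ.
by rewrite mxvec_eq0.
Qed.

Lemma root_vector_iter_lie a b X Y k : root_vector g a X -> root_vector g b Y ->
  root_vector g (b + a *+ k) (iter k (lie X) Y).
Proof.
move=> hX hY; elim: k => [|k IH]; first by rewrite addr0.
by rewrite mulrSr addrA addrC; apply: root_vector_lie.
Qed.

(** By the representation theory of sl2, applied to the triple of a simple root,
    the lowering operator maps onto every weight space on which the coroot is
    negative. *)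
Lemma simple_lowering_surj i a X n :
  a (coroot i) = - (n.+1%:R : R[i]) -> root_vector g a X ->
  forall e f, root_vector g (D i) e -> root_vector g (- D i) f ->
  vsval (coroot i) = lie e f ->
  exists2 u, root_vector g (a + D i) u & X = lie f u.
Proof.
move=> an aX e f re rf ef.
have [a2 _] := corootP i.
pose H := lie f e.
have eH : H = - vsval (coroot i) by rewrite ef /H lieC.
have comm x : lie f (lie e x) - lie e (lie f x) = lie H x.
  by rewrite lie_jacobi addrK.
have He x : lie H (lie e x) - lie e (lie H x) = - 2 *: lie e x.
  rewrite lie_jacobi addrK eH lieNl; have [_ ->] := re.
  by rewrite a2 -scaleNr lieZl.
have [k hk] : exists k, iter k (lie f) X = 0.
  apply: (@eigenvalue_progression (lie (vsval (coroot i))) (- n.+1%:R) (- 2)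
      (fun k => iter k (lie f) X)) => [|k].
    by rewrite oppr_eq0 pnatr_eq0.
  have [_ /= ->] := root_vector_iter_lie k rf aX.
  rewrite add_lfunE an weight_mulrn opp_lfunE a2; congr (_ *: _).
  by rewrite mulrC.
(* Induction on the order k of nilpotency of [ad f] on X: subtracting a multiple
   of [f, u], where u = (ad e)^(k+1) (ad f)^k X, lowers this order. *)
elim: k X aX hk => [|k IH] X aX.
  move=> /= ->; exists 0; last by rewrite linear0.
  exact: (root_vector_closed _).1.
move=> hk; pose w := iter k (lie f) X.
have rw := root_vector_iter_lie k rf aX.
pose nu : R[i] := n.+1%:R + 2 * k%:R.
have hw : lie H w = nu *: w.
  have [_ hw] := rw; rewrite eH lieNl hw -scaleNr; congr (_ *: _).
  rewrite add_lfunE an weight_mulrn opp_lfunE a2 /nu.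
  by ring.
have fw : lie f w = 0 by [].
pose u := iter k.+1 (lie e) w.
have ru : root_vector g (a + D i) u.
  have := root_vector_iter_lie k.+1 re rw.
  suff -> : a + - D i *+ k + D i *+ k.+1 = a + D i by [].
  by rewrite mulNrn mulrS addrACA addNr ?addr0 // [_ + a]addrC addrA addrNK.
pose c : R[i] := \prod_(j < k.+1) (j.+1%:R * (nu - j%:R)).
have c0 : c != 0.
  apply/prodf_neq0 => j _; rewrite mulf_neq0 ?pnatr_eq0 // gt_eqF //.
  have jk : (j <= k)%N by rewrite -ltnS.
  rewrite /nu subr_gt0 -natrM -natrD ltr_nat; lia.
have fu : iter k (lie f) (lie f u) = c *: w.
  rewrite -iterSr; exact: (sl2_e_iter_iter comm He _ fw hw).
have [||v rv ev] := IH (X - c^-1 *: lie f u).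
  - rewrite addrC -scaleNr; apply: (root_vector_closed _).2 => //.
    have := root_vector_lie rf ru.
    by rewrite addrCA addNr addr0.
  - have itB x y : iter k (lie f) (x - y) = iter k (lie f) x - iter k (lie f) y.
      by elim: (k) => //= l ->; rewrite linearB.
    have itZ d x : iter k (lie f) (d *: x) = d *: iter k (lie f) x.
      by elim: (k) => //= l ->; rewrite linearZ.
    by rewrite itB itZ fu scalerA mulVf // scale1r subrr.
exists (c^-1 *: u + v); first exact: (root_vector_closed _).2.
by rewrite linearP /= -ev addrC subrK.
Qed.

(** The coefficient [c i] is positive because distinct simple roots pair to
    nonpositive integers. *)
Lemma simple_comb_pairing (c : 'I_(rk G) -> nat) : (exists j, c j != 0%N) ->
  exists i n, [/\ (\sum_j D j *+ c j : weight) (coroot i) = n.+1%:R :> R[i] &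
                  (0 < c i)%N].
Proof.
move=> hc; have [t ht hA] := adeP G.
have [i [n hn]] := cartan_positive_pairing ht hc; exists i, n; split.
  rewrite sum_lfunE; transitivity
    ((\sum_j (c j)%:Z * cartan_integer t (rk G) i j)%:~R : R[i]).
    rewrite rmorph_sum; apply: eq_bigr => j _.
    by rewrite rmorphM /= -hA weight_mulrn.
  by rewrite hn.
rewrite lt0n; apply/negP => /eqP ci0.
suff : \sum_j (c j)%:Z * cartan_integer t (rk G) i j <= 0 by rewrite hn.
apply: sumr_le0 => j _; rewrite /cartan_integer.
case: eqP => [/val_inj <-|_]; first by rewrite ci0 mul0r.
by apply: mulr_ge0_le0 => //; case: ifP.
Qed.

(** Negative root spaces are at most one-dimensional: such a space is the image,
    under a lowering operator, of the space of a root of smaller height, or of the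
    Cartan subalgebra. *)
Lemma negative_root_space_line (c : 'I_(rk G) -> nat) : (exists j, c j != 0%N) ->
  exists Z, forall X, root_vector g (- \sum_j D j *+ c j) X -> exists t, X = t *: Z.
Proof.
have [N] := ubnP (\sum_j c j); elim: N c => // N IH c hN hc.
have [i [n [hi ci]]] := simple_comb_pairing hc.
have [_ [e [f [re rf ef]]]] := corootP i.
pose c' j := (c j - (j == i))%N.
have ec : \sum_j D j *+ c j = \sum_j D j *+ c' j + D i.
  rewrite (bigD1 i) //= [in RHS](bigD1 i) //= {1}/c' eqxx.
  rewrite -{1}(subnK ci) mulrnDr mulr1n addrAC; congr (_ + _ + _).
  by apply: eq_bigr => j /negbTE ji; rewrite /c' ji subn0.
have low X : root_vector g (- \sum_j D j *+ c j) X ->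
    exists2 u, root_vector g (- \sum_j D j *+ c' j) u & X = lie f u.
  move=> hX; have := @simple_lowering_surj i _ X n _ hX e f re rf ef.
  rewrite opp_lfunE hi => /(_ erefl)[u hu ->]; exists u => //.
  by move: hu; rewrite ec opprD addrNK.
have [hc'|hc'] := pselect (exists j, c' j != 0%N).
  have [|Z hZ] := IH c' _ hc'.
    rewrite -ltnS; apply: leq_trans hN;
      rewrite ltnS (bigD1 i) //= [X in (_ < X)%N](bigD1 i) //=.
    rewrite -addSn leq_add //; first by rewrite /c' eqxx subn1 prednK.
    by apply: leq_sum => j _; rewrite leq_subr.
  exists (lie f Z) => X /low[u /hZ[t ->] ->]; exists t.
  by rewrite linearZ.
(* the root is simple: u is in the Cartan subalgebra *)
exists f => X /low[u hu ->].
have e0 : \sum_j D j *+ c' j = 0.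
  apply: big1 => j _; have [->//|h] := eqVneq (c' j) 0%N.
  by case: hc'; exists j.
rewrite e0 oppr0 in hu; have uh := (cartan_root_vector u).2 hu.
have [_ hf] := rf; have := hf (vsproj h u); rewrite vsprojK // => e1.
by exists (- (- D i : weight) (vsproj h u)); rewrite lieC e1 scaleNr.
Qed.

Section Parabolic.
Context (P : parabolic G).
Local Notation p := (lieP P).

Lemma levi_closed : sub_closed (levi P). Proof. exact: lspan_closed. Qed.
Lemma nilrad_closed : sub_closed (nilrad P). Proof. exact: lspan_closed. Qed.

Lemma levi_sub X : levi P X -> X \in p.
Proof.
move=> hX; apply: (lspan_sub (sub_closed_vspace p) _ hX).
by move=> {hX}X [|[a [_ ha _]] /ha //]; apply: subvP (cartan_sub P) _.
Qed.

Lemma nilrad_sub X : nilrad P X -> X \in p.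
Proof.
move=> hX; apply: (lspan_sub (sub_closed_vspace p) _ hX).
by move=> {hX}X [a [_ ha _]] /ha.
Qed.

Lemma positive_root_vector_in a X : nat_comb D a -> root_vector g a X -> a != 0 ->
  X \in p.
Proof.
move=> na aX a0; have [->|X0] := eqVneq X 0; first exact: mem0v.
have := @borel_sub _ _ _ P a; apply=> //; split=> //; split; first exact/eqP.
by exists X => //; apply/eqP.
Qed.

(** A root vector of p of negative root spans its root space, so that p contains
    the whole root space; hence the root belongs to the Levi factor. *)
Lemma parabolic_root_vector a X : X \in p -> root_vector g a X -> levi P X \/ nilrad P X.
Proof.
move=> pX aX; have [->|X0] := eqVneq X 0; first by left; apply: lspan0.
have [a0|a0] := eqVneq a 0.
  by left; apply: lspan_in; left; apply/cartan_root_vector; rewrite -a0.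
have ra : is_root g a by split; [exact/eqP|exists X => //; exact/eqP].
have [_ _ hbase] := simple_rootP G.
have [ha|[c ec]] := hbase a ra.
  have pa : root_in p a by move=> Y aY; apply: positive_root_vector_in aY a0.
  have [ina|ina] := pselect (root_in p (- a)).
    by left; apply: lspan_in; right; exists a.
  by right; apply: lspan_in; exists a.
have ea : a = - \sum_j D j *+ c j by rewrite -ec opprK.
have hc : exists j, c j != 0%N.
  apply: contrapT => hn; move/eqP: a0; apply; rewrite ea.
  rewrite big1 ?oppr0 // => j _; have [->//|cj] := eqVneq (c j) 0%N.
  by case: hn; exists j.
have [Z hZ] := negative_root_space_line hc; rewrite -ea in hZ.
left; apply: lspan_in; right; exists a; split=> //.
  move=> Y /hZ[t ->]; have [s eX] := hZ X aX.
  have s0 : s != 0 by apply/eqP => s0; move/eqP: X0; apply; rewrite eX s0 scale0r.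
  by rewrite -[Z]scale1r -(mulVf s0) -scalerA -eX !rpredZ.
move=> Y aY; apply: positive_root_vector_in aY _; last by rewrite oppr_eq0.
by exists c; rewrite ec.
Qed.

(** p = r + n: p is stable under the Cartan subalgebra, hence is the sum of its
    weight spaces. *)
Lemma parabolic_levi_nilrad X : X \in p ->
  exists Y Z, [/\ levi P Y, nilrad P Z & X = Y + Z].
Proof.
move=> pX; have [_ _ hdiag _] := cartanP G.
have : wsum (fun a : weight => root_vector g a) X.
  have := hdiag X (subvP (lieP_sub P) _ pX).
  apply: lspan_sub; first exact/wsum_closed/root_vector_closed.
  by move=> Y [a aY]; apply: wsum_in aY; apply: root_vector_closed.
move=> [s [y [us hy eX]]]; rewrite eX.
have py a : a \in s -> y a \in p.
  move: a; apply: (@weight_components _ _ _ _ (fun (H : subvs_of h) Y => lie (vsval H) Y)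
      (fun a H => a H) _ _ _ (sub_closed_vspace p)) => //.
  - by move=> H; apply: lie_is_linear.
  - by move=> a b e; apply/lfunP.
  - move=> H Y pY; apply: lieP_subalgebra => //.
    exact: subvP (cartan_sub P) _ (subvsP H).
  - by move=> a /hy[_ ha] H; apply: ha.
  - by rewrite -eX.
elim: s {us eX} hy py => [|a s IH] hy py.
  exists 0, 0; rewrite big_nil addr0; split=> //; exact: lspan0.
have [Y [Z [hY hZ e]]] : exists Y Z, [/\ levi P Y, nilrad P Z & \sum_(j <- s) y j = Y + Z].
  by apply: IH => b hb; [apply: hy|apply: py]; rewrite inE hb orbT.
rewrite big_cons e.
have [hl|hn] := parabolic_root_vector (py a (mem_head _ _)) (hy a (mem_head _ _)).
  exists (y a + Y), Z; rewrite addrA; split=> //.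
  exact: sub_closedD levi_closed hl hY.
exists Y, (y a + Z); rewrite addrCA; split=> //.
exact: sub_closedD nilrad_closed hn hZ.
Qed.

Lemma parabolic_ind (Q : 'M[R[i]]_m -> Prop) : sub_closed Q ->
  (forall X, levi P X -> Q X) -> (forall X, nilrad P X -> Q X) ->
  forall X, X \in p -> Q X.
Proof.
move=> QP hl hn X /parabolic_levi_nilrad[Y [Z [hY hZ ->]]].
exact: sub_closedD QP (hl _ hY) (hn _ hZ).
Qed.

End Parabolic.

End RootSpaces.

(** * Irreducible modules and highest weights *)

Section IrreducibleModules.
Context {R : realType} {m : nat} {G : adeGroup R m} (P : parabolic G).
Local Notation g := (lieG G).
Local Notation p := (lieP P).
Local Notation weight := 'Hom(subvs_of (cartan G), R[i]^o).
Local Notation D := (@simple_root R m G).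

(** Nonzero vectors of weight [lam] killed by the positive root vectors. *)
Definition highest_weight_vector d (T : 'M[R[i]]_m -> 'M[R[i]]_d) (lam : weight)
    (v : 'cV[R[i]]_d) : Prop :=
  [/\ v <> 0,
      forall H, T (vsval H) *m v = (lam H : R[i]) *: v &
      forall (a : weight) X, positive_root a -> root_vector g a X -> T X *m v = 0].

Lemma parabolic_root_ind (Q : 'M[R[i]]_m -> Prop) : sub_closed Q ->
  (forall (a : weight) X, X \in p -> root_vector g a X -> Q X) ->
  forall X, X \in p -> Q X.
Proof.
move=> QP h; apply: parabolic_ind => // X hX.
  apply: (lspan_sub QP _ hX) => Y [hY|[a [_ pa _ aY]]].
    apply: (h 0) => //; last exact/cartan_root_vector.
    exact: subvP (cartan_sub P) _ hY.
  exact: h (pa _ aY) aY.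
by apply: (lspan_sub QP _ hX) => Y [a [_ pa _ aY]]; apply: h (pa _ aY) aY.
Qed.

Lemma intertwiner_levi d d' (T : {linear 'M[R[i]]_m -> 'M[R[i]]_d})
    (T' : {linear 'M[R[i]]_m -> 'M[R[i]]_d'}) (A : 'M[R[i]]_(d', d)) :
  (forall X, nilrad P X -> T X = 0) -> (forall X, nilrad P X -> T' X = 0) ->
  (forall X, levi P X -> A *m T X = T' X *m A) ->
  forall X, X \in p -> A *m T X = T' X *m A.
Proof.
move=> n0 n0' hA; apply: parabolic_ind => [|//|X hX]; last first.
  by rewrite n0 // n0' // mulmx0 mul0mx.
split=> [|c X Y hX hY]; first by rewrite [T 0]linear0 [T' 0]linear0 mulmx0 mul0mx.
by rewrite [T _]linearP [T' _]linearP /= mulmxDr mulmxDl -scalemxAr -scalemxAl hX hY.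
Qed.

Section Module.
Context {d : nat} (T : {linear 'M[R[i]]_m -> 'M[R[i]]_d}).
Hypothesis T_rep : lie_rep p T.
Hypothesis T_irr : forall U : {vspace 'cV[R[i]]_d},
  (forall X u, X \in p -> u \in U -> T X *m u \in U) -> U = 0%VS \/ U = fullv.

(** Irreducibility, for subspaces given as predicates. *)
Lemma irreducible_pred (S : 'cV[R[i]]_d -> Prop) : sub_closed S ->
  (forall X u, X \in p -> S u -> S (T X *m u)) ->
  (forall u, S u -> u = 0) \/ (forall u, S u).
Proof.
move=> SP hS; have [U hU] := vspace_of_sub_closed SP.
have [|U0|U1] := T_irr (U := U).
- by move=> X u hX /hU hu; apply/hU; apply: hS.
- by left=> u /hU; rewrite U0 memv0 => /eqP.
- by right=> u; apply/hU; rewrite U1 memvf.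
Qed.

(** [lowered lam v a u]: [u] is a combination, of weight [a], of the vectors
    obtained from [v] by successive application of root vectors of negative
    weight. *)
Inductive lowered (lam : weight) (v : 'cV[R[i]]_d) : weight -> 'cV[R[i]]_d -> Prop :=
| lowered_top : lowered lam v lam v
| lowered0 a : lowered lam v a 0
| lowered_lin a c x y :
    lowered lam v a x -> lowered lam v a y -> lowered lam v a (c *: x + y)
| lowered_step a b Y u :
    nat_comb D b -> Y \in p -> root_vector g (- b) Y -> lowered lam v a u ->
    lowered lam v (a - b) (T Y *m u).

Context (lam : weight) (v : 'cV[R[i]]_d).
Hypothesis hv : highest_weight_vector T lam v.

Lemma T_swap X Y (u : 'cV[R[i]]_d) : X \in p -> Y \in p ->
  T X *m (T Y *m u) = T (lie X Y) *m u + T Y *m (T X *m u).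
Proof. by move=> hX hY; rewrite T_rep // /lie mulmxBl !mulmxA subrK. Qed.

Lemma lowered_weight a u : lowered lam v a u ->
  forall H, T (vsval H) *m u = (a H : R[i]) *: u.
Proof.
elim=> [|b H|b c x y _ hx _ hy H|b b' Y w _ pY rY _ hw H].
- by have [_ h _] := hv.
- by rewrite mulmx0 scaler0.
- by rewrite mulmxDr -scalemxAr hx hy scalerDr !scalerA mulrC.
- have pH : vsval H \in p by apply: subvP (cartan_sub P) _ (subvsP H).
  rewrite T_swap // hw; have [_ ->] := rY.
  by rewrite linearZ /= -scalemxAl -scalemxAr -scalerDl opp_lfunE add_lfunE opp_lfunE addrC.
Qed.

Lemma lowered_le a u : lowered lam v a u -> u = 0 \/
  exists c : 'I_(rk G) -> nat, a = lam - \sum_j D j *+ c j.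
Proof.
elim=> [|b|b c x y _ hx _ hy|b b' Y w [c' eb'] _ _ _ hw].
- by right; exists (fun=> 0%N); rewrite big1 ?subr0.
- by left.
- case: hx => [->|]; last by right.
  by case: hy => [->|]; [left; rewrite scaler0 addr0|right].
- case: hw => [->|[c ->]]; first by left; rewrite mulmx0.
  right; exists (fun j => c j + c' j)%N; rewrite -addrA -opprD; congr (_ - _).
  by rewrite eb' -big_split; apply: eq_bigr => j _; rewrite mulrnDr.
Qed.

Let spanned := wsum (lowered lam v).

Lemma lowered_closed a : sub_closed (lowered lam v a).
Proof. by split; [exact: lowered0|exact: lowered_lin]. Qed.

Lemma spanned_closed : sub_closed spanned.
Proof. exact: wsum_closed lowered_closed. Qed.

Lemma spanned_lower (b : weight) Y u : nat_comb D b -> Y \in p -> root_vector g (- b) Y ->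
  spanned u -> spanned (T Y *m u).
Proof.
move=> hb pY rY [s [y [us hy ->]]]; rewrite mulmx_sumr big_seq.
apply: sub_closed_sum; first exact: spanned_closed.
move=> a /hy ha; apply: (wsum_in lowered_closed (a := a - b)).
exact: lowered_step.
Qed.

(** By the commutation relations, the span of the lowered vectors is a
    submodule. *)
Lemma lowered_stable a u : lowered lam v a u ->
  forall (b : weight) Z, Z \in p -> root_vector g b Z -> spanned (T Z *m u).
Proof.
elim=> [b Z pZ rZ|c b Z _ _|c t x y _ hx _ hy b Z pZ rZ|c b' Y w hb' pY rY _ hw b Z pZ rZ].
- have top t : spanned (t *: v).
    by apply: sub_closedZ spanned_closed _;
      apply: (wsum_in lowered_closed (lowered_top _ _)).
  have [v0 hvH hvp] := hv.
  have [Z0|Z0] := eqVneq Z 0.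
    by rewrite Z0 linear0 mul0mx; apply: (spanned_closed).1.
  have [b0|b0] := eqVneq b 0.
    have hZ : Z \in cartan G by apply/cartan_root_vector; rewrite -b0.
    by have := hvH (vsproj (cartan G) Z); rewrite vsprojK // => ->.
  have rb : is_root g b by split; [exact/eqP|exists Z => //; exact/eqP].
  have [_ _ hbase] := simple_rootP G.
  have [hb|hb] := hbase b rb.
    by rewrite (hvp b) //; apply: (spanned_closed).1.
  apply: (wsum_in lowered_closed (a := lam - - b)); apply: lowered_step => //.
    by rewrite opprK.
  exact: lowered_top.
- by rewrite mulmx0; apply: (spanned_closed).1.
- rewrite mulmxDr -scalemxAr; exact: spanned_closed.2 _ _ _ (hx _ _ pZ rZ) (hy _ _ pZ rZ).
- rewrite T_swap //; apply: sub_closedD spanned_closed _ _.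
    exact: hw (lieP_subalgebra pZ pY) (root_vector_lie rZ rY).
  exact: spanned_lower hb' pY rY (hw _ _ pZ rZ).
Qed.

(** The lowered vectors span the irreducible module, so that the weight of any
    highest weight vector is below [lam]. *)
Lemma highest_weight_le mu v' : highest_weight_vector T mu v' ->
  exists c : 'I_(rk G) -> nat, mu = lam - \sum_j D j *+ c j.
Proof.
move=> [v'0 hv' _]; have SP := spanned_closed.
have Sv : spanned v by apply: (wsum_in lowered_closed (lowered_top _ _)).
have [|h|h] := irreducible_pred SP.
- move=> X u pX Su; move: X pX; apply: parabolic_root_ind.
    split=> [|c X Y hX hY]; first by rewrite linear0 mul0mx; apply: SP.1.
    by rewrite linearP /= mulmxDl -scalemxAl; apply: SP.2.
  move=> a X pX aX; have [s [y [us hy ->]]] := Su.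
  rewrite mulmx_sumr big_seq; apply: sub_closed_sum => // b /hy hb.
  exact: lowered_stable hb _ _ pX aX.
- by have [v0 _ _] := hv; case: v0; apply: h.
have [s [y [us hy e]]] := h v'.
pose line x := exists t : R[i], x = t *: v'.
have lineP : sub_closed line.
  split; first by exists 0; rewrite scale0r.
  by move=> c _ _ [t ->] [t' ->]; exists (c * t + t'); rewrite scalerDl scalerA.
(* the line of v' is stable under the Cartan subalgebra *)
have comps a : a \in s -> line (y a).
  move: a; apply: (@weight_components _ _ _ _ (fun (H : subvs_of (cartan G)) x => T (vsval H) *m x)
      (fun (a : weight) H => a H) _ _ line lineP) => //.
  - by move=> H c x x'; rewrite mulmxDr -scalemxAr.
  - by move=> a b eab; apply/lfunP.
  - by move=> H _ [t ->]; rewrite -scalemxAr hv' scalerA; exists (t * mu H).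
  - by move=> a /hy ha H; apply: lowered_weight.
  - by rewrite -e; exists 1; rewrite scale1r.
have [a [sa ya]] : exists a, a \in s /\ y a <> 0.
  apply: contrapT => hn; apply: v'0; rewrite e; apply: big1_seq => a /andP[_ sa].
  by apply: contrapT => ya; apply: hn; exists a.
have [ya0//|[c ea]] := lowered_le (hy a sa).
exists c; rewrite -ea; apply/lfunP => H.
have [t et] := comps a sa; have t0 : t != 0.
  by apply/eqP => t0; apply: ya; rewrite et t0 scale0r.
have := lowered_weight (hy a sa) H; rewrite et -scalemxAr hv' !scalerA => /eqP.
rewrite -subr_eq0 -scalerBl scaler_eq0 => /orP[|/eqP//].
by rewrite mulrC -mulrBl mulf_eq0 (negbTE t0) orbF subr_eq0 => /eqP.
Qed.

Lemma schur_scalar (A : 'M[R[i]]_d) :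
  (forall X, X \in p -> A *m T X = T X *m A) -> exists a, A = a%:M.
Proof.
move=> hA; have d0 : (0 < d)%N.
  rewrite lt0n; apply/eqP => d0; have [v0 _ _] := hv; apply: v0.
  apply/matrixP => i; suff : false by [].
  by move: (ltn_ord i); move: (i : nat) => k; rewrite d0.
have [a ha] : exists a, root (char_poly A^T) a.
  by apply: closed_rootP; rewrite size_char_poly eqSS -lt0n.
have /eigenvalueP[w hw w0] : eigenvalue A^T a by rewrite eigenvalue_root_char.
have hw' : A *m w^T = a *: w^T by rewrite -[A]trmxK -trmx_mul hw linearZ.
exists a; have [||h|h] := @irreducible_pred (fun u => A *m u = a *: u).
- split=> [|c x y hx hy]; first by rewrite mulmx0 scaler0.
  by rewrite mulmxDr -scalemxAr hx hy scalerDr !scalerA mulrC.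
- by move=> X u pX hu; rewrite mulmxA hA // -mulmxA hu -scalemxAr.
- by case/eqP: w0; rewrite -[w]trmxK (h _ hw') trmx0.
apply/matrixP => i j; have := h (delta_mx j 0).
by rewrite -colE -mul_scalar_mx -colE => /matrixP /(_ i 0); rewrite !mxE.
Qed.

End Module.

Lemma highest_weight_unique d (T : {linear 'M[R[i]]_m -> 'M[R[i]]_d}) lam mu v v' :
  irreducible_of_weight P lam T ->
  highest_weight_vector T lam v -> highest_weight_vector T mu v' -> lam = mu.
Proof.
move=> [hrep _ hirr _] hv hv'.
have [c ec] := highest_weight_le hrep hirr hv hv'.
have [c' ec'] := highest_weight_le hrep hirr hv' hv.
have s0 : \sum_j D j *+ (c j + c' j) = 0.
  under eq_bigr do rewrite mulrnDr.
  rewrite big_split /=; move: (ec) (ec').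
  move: (\sum_j D j *+ c j) (\sum_j D j *+ c' j) => x y ex /eqP.
  by rewrite ex -addrA -opprD -subr_eq0 opprB addrCA subrr addr0 => /eqP.
have [h|h] := pselect (exists j, (c j + c' j)%N != 0%N).
  have [i [n [e _]]] := simple_comb_pairing h.
  by move/eqP: e; rewrite s0 lfunE /= eq_sym pnatr_eq0.
rewrite ec big1 ?subr0 // => j _; have [->//|cj] := eqVneq (c j) 0%N.
by case: h; exists j; rewrite addn_eq0 negb_and cj.
Qed.

Lemma schur_zero d d' (T : {linear 'M[R[i]]_m -> 'M[R[i]]_d})
    (T' : {linear 'M[R[i]]_m -> 'M[R[i]]_d'}) lam mu (A : 'M[R[i]]_(d', d)) :
  irreducible_of_weight P lam T -> irreducible_of_weight P mu T' ->
  (forall X, X \in p -> A *m T X = T' X *m A) -> A = 0 \/ lam = mu.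
Proof.
move=> hT hT' hA; have [hrep _ hirr [v [v0 hvH hvp]]] := hT.
have [||h|h] := @irreducible_pred _ T hirr (fun u => A *m u = 0).
- split=> [|c x y hx hy]; first by rewrite mulmx0.
  by rewrite mulmxDr -scalemxAr hx hy scaler0 addr0.
- by move=> X u pX hu; rewrite mulmxA hA // -mulmxA hu mulmx0.
- right; have [_ _ _ [v' hv']] := hT'.
  apply/esym; apply: (highest_weight_unique hT' hv' (v' := A *m v)); split.
  + by move=> Av; apply: v0; apply: h.
  + move=> H; have pH : vsval H \in p by apply: subvP (cartan_sub P) _ (subvsP H).
    by rewrite mulmxA -hA // -mulmxA hvH -scalemxAr.
  + move=> a X ha aX; have pX : X \in p := borel_sub P ha aX.
    by rewrite mulmxA -hA // -mulmxA (hvp a) // mulmx0.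
left; apply/matrixP => i j; have := h (delta_mx j 0).
by rewrite -colE => /matrixP /(_ i 0); rewrite !mxE.
Qed.

End IrreducibleModules.

(** * Invariant sections and the graded bundle *)

Section InvariantEndomorphisms.
Context {R : realType} {m : nat} {G : adeGroup R m} {P : parabolic G} {r : nat}.
Context (E : homBundle P r).
Local Notation p := (lieP P).

Lemma analytic_subgroup_unit n (a : {vspace 'M[R[i]]_n}) x :
  analytic_subgroup a x -> x \in unitmx.
Proof.
by elim=> [|X y _ _ hy]; rewrite ?unitmx1 // unitmx_mul mexp_unit.
Qed.

Lemma analytic_subgroupS n (a b : {vspace 'M[R[i]]_n}) x : (a <= b)%VS ->
  analytic_subgroup a x -> analytic_subgroup b x.
Proof.
move=> ab; elim=> [|X y hX _ hy]; first exact: analytic_one.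
by apply: analytic_mul => //; apply: subvP ab _ hX.
Qed.

Lemma mexp_inP X : X \in p -> inP P (mexp X).
Proof. by move=> pX; rewrite -[mexp X]mulmx1;
  apply: analytic_mul pX (analytic_one _). Qed.

Lemma rho_unit y : inP P y -> rho E y \in unitmx.
Proof.
elim=> [|X z pX hz IH]; first by rewrite rho1 unitmx1.
by rewrite (rhoM E (mexp_inP pX) hz) rho_exp // unitmx_mul mexp_unit.
Qed.

Lemma rho_comm A : (forall X, X \in p -> A *m drho E X = drho E X *m A) ->
  forall y, inP P y -> A *m rho E y = rho E y *m A.
Proof.
move=> hA y; elim=> [|X z pX hz IH]; first by rewrite rho1 mulmx1 mul1mx.
rewrite (rhoM E (mexp_inP pX) hz) rho_exp // mulmxA (mexp_comm (hA _ pX)).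
by rewrite -!mulmxA IH.
Qed.

Lemma drho_comm A : (forall y, inP P y -> A *m rho E y = rho E y *m A) ->
  forall X, X \in p -> A *m drho E X = drho E X *m A.
Proof.
move=> hA X pX; apply: mexp_comm_inv => t.
have -> : t%:C *: drho E X = drho E (t%:C *: X) by rewrite linearZ.
by rewrite -rho_exp ?rpredZ //; apply: hA; apply: mexp_inP; rewrite rpredZ.
Qed.

(** A G-invariant section of the homogeneous bundle End E is determined by its
    value at the base point, which is an endomorphism of the p-module. *)
Lemma invariant_section s : H0_End_inv E s ->
  (forall x, inG G x -> s x = s 1%:M) /\
  (forall X, X \in p -> s 1%:M *m drho E X = drho E X *m s 1%:M).
Proof.
move=> [[_ heq] hinv].
have hs x : inG G x -> s x = s 1%:M.
  move=> Gx; have := hinv x x Gx Gx; rewrite /translate mulVmx //.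
  exact: analytic_subgroup_unit Gx.
split=> //; apply: drho_comm => y Py.
have := heq 1%:M y (analytic_one _) Py; rewrite mul1mx hs; last first.
  exact: analytic_subgroupS (lieP_sub P) Py.
move=> e; rewrite [in RHS]e !mulmxA mulmxV ?mul1mx //; exact: rho_unit.
Qed.

Lemma constant_section (A : 'M[R[i]]_r) :
  (forall X, X \in p -> A *m drho E X = drho E X *m A) -> H0_End_inv E (fun=> A).
Proof.
move=> hA; split=> //; split.
  move=> x _; exists (\0 : {linear 'M[R[i]]_m -> 'M[R[i]]_r}) => e e0.
  exists 1 => // X _ _; rewrite subrr sub0r /= oppr0 mx_norm0.
  by apply: mulr_ge0; [exact: ltW|by rewrite mx_normE].
move=> x y _ Py; rewrite -mulmxA rho_comm // mulmxA mulVmx ?mul1mx //.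
exact: rho_unit.
Qed.

End InvariantEndomorphisms.

Section GradedDecomposition.
Context {R : realType} {m : nat} {G : adeGroup R m} {P : parabolic G} {r : nat}.
Context {E : homBundle P r} {I : irrFamily P} {f : generators I}.
Context {D : gradedBundle E I} (Q : quiverRep f D) (hE : multiplicity_free D).
Local Notation p := (lieP P).
Local Notation n := (nvert D).
Local Notation dim i := (idim I (vert i)).
Local Notation T i := (irep I (vert i)).

(** The only index of the multiplicity space of the vertex [i]. *)
Definition mult_index (i : 'I_n) : 'I_(mult i) := Ordinal (mult_gt0 i).

(** The embedding of the summand of gr E at the vertex [i]. *)
Definition summand (i : 'I_n) : 'M[R[i]]_(r, dim i) := emb (mult_index i).
Local Notation eps := summand.

Lemma mult_indexE (i : 'I_n) (a : 'I_(mult i)) : a = mult_index i.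
Proof.
apply: val_inj => /=; have := ltn_ord a; move: (a : nat) => k.
by rewrite (hE i); case: k.
Qed.

Lemma sum_mult (V : nmodType) (i : 'I_n) (F : 'I_(mult i) -> V) :
  \sum_(a < mult i) F a = F (mult_index i).
Proof.
by apply: big_pred1 => a; rewrite /= [a]mult_indexE eqxx.
Qed.

Lemma summand_coordinates (w : 'cV[R[i]]_r) :
  exists u : forall i : 'I_n, 'cV[R[i]]_(dim i), w = \sum_i eps i *m u i.
Proof.
have [u [-> _]] := emb_iso D w; exists (fun i => u i (mult_index i)).
by apply: eq_bigr => i _; rewrite sum_mult.
Qed.

Lemma summand_free (u : forall i : 'I_n, 'cV[R[i]]_(dim i))
    (u' : forall i : 'I_n, 'cV[R[i]]_(dim i)) :
  \sum_i eps i *m u i = \sum_i eps i *m u' i -> forall i, u i = u' i.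
Proof.
move=> e i; have [v [_ hv]] := emb_iso D (\sum_i eps i *m u i).
have h1 := hv (fun i _ => u i); have h2 := hv (fun i _ => u' i).
have e1 : v = fun i _ => u i.
  by apply: h1; apply: eq_bigr => j _; rewrite sum_mult.
have e2 : v = fun i _ => u' i.
  by apply: h2; rewrite e; apply: eq_bigr => j _; rewrite sum_mult.
by have := congr1 (fun w => w i (mult_index i)) (etrans (esym e1) e2).
Qed.

(** The components of a vector in the direct sum gr E. *)
Definition coordinates (w : 'cV[R[i]]_r) := projT1 (cid (summand_coordinates w)).

(** The projection of gr E onto its summand at [i]. *)
Definition projection (i : 'I_n) : 'M[R[i]]_(dim i, r) :=
  \matrix_(k, l) coordinates (delta_mx l 0) i k 0.
Local Notation pi := projection.

Lemma mx_eq_col a b (A B : 'M[R[i]]_(a, b)) :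
  (forall u : 'cV[R[i]]_b, A *m u = B *m u) -> A = B.
Proof.
by move=> h; apply/matrixP => i j; have := h (delta_mx j 0);
  rewrite -!colE => /matrixP /(_ i 0); rewrite !mxE.
Qed.

Lemma sum_summand_projection : \sum_i eps i *m pi i = 1%:M.
Proof.
apply/matrixP => k l.
have e : col l (\sum_i eps i *m pi i) = delta_mx l 0.
  rewrite [RHS](projT2 (cid (summand_coordinates (delta_mx l 0)))).
  rewrite colE mulmx_suml; apply: eq_bigr => i _; rewrite -mulmxA; congr (_ *m _).
  by rewrite -colE; apply/matrixP => a b; rewrite !mxE (ord1 b).
by move/matrixP: e => /(_ k 0); rewrite !mxE eqxx andbT.
Qed.

Lemma projection_summand_family (j : 'I_n) (u : 'cV[R[i]]_(dim j)) (i : 'I_n) :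
  pi i *m eps j *m u =
    @eqtype.dfwith _ (fun k : 'I_n => 'cV[R[i]]_(dim k)) (fun k => 0) j u i.
Proof.
move: i; apply: summand_free; rewrite [RHS](bigD1 j) //= eqtype.dfwith_in.
rewrite [X in _ = _ + X]big1 => [|k kj]; last first.
  by rewrite eqtype.dfwith_out 1?eq_sym // mulmx0.
under eq_bigr do rewrite !mulmxA.
by rewrite -!mulmx_suml sum_summand_projection mul1mx addr0.
Qed.

Lemma projection_summand (i : 'I_n) : pi i *m eps i = 1%:M.
Proof.
by apply: mx_eq_col => u; rewrite mul1mx projection_summand_family eqtype.dfwith_in.
Qed.

Lemma projection_summand_neq (i j : 'I_n) : i != j -> pi i *m eps j = 0.
Proof.
move=> ij; apply: mx_eq_col => u; rewrite mul0mx projection_summand_family.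
by rewrite eqtype.dfwith_out // eq_sym.
Qed.

Lemma eq_on_summands (A B : 'M[R[i]]_r) :
  (forall i : 'I_n, A *m eps i = B *m eps i) -> A = B.
Proof.
move=> h; rewrite -[A]mulmx1 -[B]mulmx1 -sum_summand_projection !mulmx_sumr.
by apply: eq_bigr => i _; rewrite !mulmxA h.
Qed.

Lemma summand_levi (i : 'I_n) X : levi P X -> drho E X *m eps i = eps i *m T i X.
Proof. exact: emb_levi. Qed.

Lemma projection_levi (i : 'I_n) X : levi P X -> pi i *m drho E X = T i X *m pi i.
Proof.
move=> hX; rewrite -[LHS]mulmx1 -sum_summand_projection mulmx_sumr (bigD1 i) //=.
rewrite big1 => [|j ji].
  by rewrite addr0 -mulmxA [drho E X *m _]mulmxA summand_levi // !mulmxA projection_summand mul1mx.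
by rewrite -mulmxA [drho E X *m _]mulmxA summand_levi // !mulmxA projection_summand_neq 1?eq_sym // !mul0mx.
Qed.

Lemma summand_irreducible (i : 'I_n) : irreducible_of_weight P (vert i) (T i).
Proof. exact: irepP (vert_dominant i). Qed.

(** Schur: as the summands are irreducible and pairwise non-isomorphic, an
    endomorphism of gr E acts on each of them by a scalar. *)
Lemma levi_endomorphism (A : 'M[R[i]]_r) :
  (forall X, levi P X -> A *m drho E X = drho E X *m A) ->
  exists a : 'I_n -> R[i], forall i : 'I_n, A *m eps i = a i *: eps i.
Proof.
move=> hA.
have hB i j X : X \in p -> (pi j *m A *m eps i) *m T i X = T j X *m (pi j *m A *m eps i).
  move: X; apply: intertwiner_levi.
  - by have [_ h _ _] := summand_irreducible i.
  - by have [_ h _ _] := summand_irreducible j.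
  move=> X hX; rewrite -mulmxA -summand_levi // mulmxA -(mulmxA (pi j) A) hA //.
  by rewrite !mulmxA projection_levi // !mulmxA.
have h0 i j : j != i -> pi j *m A *m eps i = 0.
  move=> ji; have [//|/vert_inj e] :=
    schur_zero (summand_irreducible i) (summand_irreducible j) (hB i j).
  by rewrite e eqxx in ji.
have h1 i : exists a, pi i *m A *m eps i = a%:M.
  have [hr _ hi [v hv]] := summand_irreducible i.
  exact: (schur_scalar hi hv (hB i i)).
have [a ha] := boolp.choice h1; exists a => i.
(* A eps_i is the sum over j of eps_j (pi_j A eps_i) *)
rewrite -[A]mul1mx -sum_summand_projection !mulmx_suml (bigD1 i) //=.
rewrite big1 => [|j ji]; last by rewrite -!mulmxA mulmxA mulmxA -(mulmxA (eps j)) -(mulmxA (eps j)) h0 // mulmx0.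
by rewrite addr0 -!mulmxA [pi i *m _]mulmxA ha mul_mx_scalar.
Qed.

(** The endomorphism of gr E acting by [a i] on the summand at [i]. *)
Definition diagonal_endo (a : 'I_n -> R[i]) : 'M[R[i]]_r :=
  \sum_i a i *: (eps i *m pi i).

Lemma diagonal_endo_summand a (i : 'I_n) : diagonal_endo a *m eps i = a i *: eps i.
Proof.
rewrite /diagonal_endo mulmx_suml (bigD1 i) //= big1 => [|j ji].
  by rewrite addr0 -scalemxAl -mulmxA projection_summand mulmx1.
by rewrite -scalemxAl -mulmxA projection_summand_neq // mulmx0 scaler0.
Qed.

Lemma diagonal_endo_levi a X : levi P X ->
  diagonal_endo a *m drho E X = drho E X *m diagonal_endo a.
Proof.
move=> hX; apply: eq_on_summands => i; rewrite -!mulmxA diagonal_endo_summand.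
by rewrite summand_levi // mulmxA diagonal_endo_summand -scalemxAl -scalemxAr summand_levi.
Qed.

Lemma summand_neq0 (i : 'I_n) : eps i != 0.
Proof.
have [_ _ _ [v [v0 _ _]]] := summand_irreducible i.
apply/eqP => e; apply: v0.
by rewrite -[v]mul1mx -projection_summand e mulmx0 mul0mx.
Qed.

Lemma diagonal_endo_inj a a' : diagonal_endo a = diagonal_endo a' -> a =1 a'.
Proof.
move=> e i; have := diagonal_endo_summand a i; rewrite e diagonal_endo_summand => /eqP.
by rewrite -subr_eq0 -scalerBl scaler_eq0 (negbTE (summand_neq0 i)) orbF subr_eq0 => /eqP.
Qed.

(** The value g_ij of [E] on the arrow from [i] to [j], as a scalar. *)
Definition arrow_scalar (i j : 'I_n) : R[i] := gmap Q i j (mult_index j) (mult_index i).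

Lemma summand_nilrad (i : 'I_n) Y : nilrad P Y -> drho E Y *m eps i =
  \sum_j arrow_scalar i j *: (eps j *m gen f (vert i) (vert j) Y).
Proof.
move=> hY; rewrite (gmapP Q _ hY); apply: eq_bigr => j _.
by rewrite sum_mult.
Qed.

Lemma projection_nilrad (i j : 'I_n) Y : nilrad P Y ->
  pi j *m (drho E Y *m eps i) = arrow_scalar i j *: gen f (vert i) (vert j) Y.
Proof.
move=> hY; rewrite summand_nilrad // mulmx_sumr (bigD1 j) //= big1 => [|k kj].
  by rewrite addr0 -scalemxAr mulmxA projection_summand mul1mx.
by rewrite -scalemxAr mulmxA projection_summand_neq 1?eq_sym // mul0mx scaler0.
Qed.

Lemma gmap_neq0 (i j : 'I_n) : gmap Q i j <> 0 <-> arrow_scalar i j != 0.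
Proof.
split=> [h|h].
  apply/eqP => e; apply: h; apply/matrixP => b a.
  by rewrite [b]mult_indexE [a]mult_indexE -/(arrow_scalar i j) e mxE.
by move=> e; move/eqP: h; apply; rewrite /arrow_scalar e mxE.
Qed.

(** There is an arrow if and only if the chosen generator is nonzero on n. *)
Lemma arrow_gen (i j : 'I_n) : arrow I (vert i) (vert j) <->
  exists2 Y, nilrad P Y & gen f (vert i) (vert j) Y <> 0.
Proof.
have [he hg] := genP f (vert_dominant i) (vert_dominant j).
split=> [[F [/hg[c hc] [Y hY FY]]]|[Y hY fY]].
  by exists Y => // e; apply: FY; rewrite hc // e scaler0.
by exists (gen f (vert i) (vert j)); split=> //; exists Y.
Qed.

(** A diagonal endomorphism commutes with n precisely when it is constant along
    the arrows of the quiver representation. *)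
Lemma diagonal_endo_nilrad a :
  (forall Y, nilrad P Y -> diagonal_endo a *m drho E Y = drho E Y *m diagonal_endo a) <->
  (forall i j, Defs.adjacent Q i j -> a i = a j).
Proof.
split=> [h|h Y hY].
  suff h' i j : support_arrow Q i j -> a i = a j.
    by move=> i j /asboolP[/h'|/h'].
  move=> [/arrow_gen[Y hY fY] /gmap_neq0 g0].
  have := congr1 (fun A => pi j *m (A *m eps i)) (h Y hY).
  rewrite -!mulmxA diagonal_endo_summand -!scalemxAr projection_nilrad //.
  rewrite summand_nilrad // mulmx_sumr.
  under eq_bigr do rewrite -scalemxAr mulmxA diagonal_endo_summand -scalemxAl.
  rewrite mulmx_sumr (bigD1 j) //= big1 => [|k kj]; last first.
    by rewrite -!scalemxAr mulmxA projection_summand_neq 1?eq_sym // mul0mx !scaler0.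
  rewrite addr0 -!scalemxAr mulmxA projection_summand mul1mx !scalerA.
  move/eqP; rewrite -subr_eq0 -scalerBl scaler_eq0 => /orP[|/eqP//].
  by rewrite [X in _ - X]mulrC -mulrBr mulf_eq0 (negbTE g0) subr_eq0 => /eqP.
apply: eq_on_summands => i; rewrite -!mulmxA diagonal_endo_summand -scalemxAr.
rewrite summand_nilrad // mulmx_sumr scaler_sumr; apply: eq_bigr => j _.
rewrite -scalemxAr mulmxA diagonal_endo_summand -scalemxAl !scalerA.
have [->|g0] := eqVneq (arrow_scalar i j) 0; first by rewrite mul0r mulr0.
have [e|fY] := pselect (gen f (vert i) (vert j) Y = 0).
  by rewrite e mulmx0 !scaler0.
suff -> : a i = a j by rewrite mulrC.
apply: h; apply/asboolP; left; split; last exact/gmap_neq0.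
by apply/arrow_gen; exists Y.
Qed.

End GradedDecomposition.

(** * Connected components of the quiver *)

Section Components.
Context {R : realType} {m : nat} {G : adeGroup R m} {P : parabolic G} {r : nat}.
Context {E : homBundle P r} {I : irrFamily P} {f : generators I}.
Context {D : gradedBundle E I} (Q : quiverRep f D) (hE : multiplicity_free D).
Local Notation n := (nvert D).
Local Notation adj := (Defs.adjacent Q).

Lemma adjacent_connect_sym : connect_sym adj.
Proof.
apply: sym_connect_sym => i j; apply/asboolP/asboolP; by case; [right|left].
Qed.

Lemma connect_constant (T : eqType) (a : 'I_n -> T) :
  (forall i j, adj i j -> a i = a j) -> forall i, a (fingraph.root adj i) = a i.
Proof.
move=> h i; have /connectP[s hs ->] := connect_root adj i.
elim: s i hs => //= j s IH i /andP[ij hs].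
by rewrite IH // (h _ _ ij).
Qed.

(** The chosen representative of the [k]-th connected component. *)
Local Notation comp_root k := (@enum_val _ (predI (fingraph.roots adj) 'I_n) k).

(** The idempotent of gr E onto the summands in the [k]-th connected component. *)
Definition component_endo (k : 'I_(nb_components Q)) : 'M[R[i]]_r :=
  diagonal_endo hE (fun i => (fingraph.root adj i == comp_root k)%:R).

Lemma sum_component_endo (c : 'rV[R[i]]_(nb_components Q)) :
  \sum_k c 0 k *: component_endo k =
  diagonal_endo hE (fun i => \sum_k c 0 k * (fingraph.root adj i == comp_root k)%:R).
Proof.
rewrite /diagonal_endo; under eq_bigr do rewrite scaler_sumr.
rewrite exchange_big /=; apply: eq_bigr => i _; rewrite scaler_suml.
by apply: eq_bigr => k _; rewrite scalerA.
Qed.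

Lemma root_comp_root (k : 'I_(nb_components Q)) : fingraph.root adj (comp_root k) = comp_root k.
Proof. by have /andP[/eqP] := enum_valP k. Qed.

Lemma sum_indicator (c : 'I_(nb_components Q) -> R[i]) i k :
  fingraph.root adj i = comp_root k ->
  \sum_l c l * (fingraph.root adj i == comp_root l)%:R = c k.
Proof.
move=> e; rewrite (bigD1 k) //= e eqxx mulr1 big1 ?addr0 // => l lk.
by rewrite (inj_eq enum_val_inj) eq_sym (negbTE lk) mulr0.
Qed.

Lemma exists_comp_root i : exists k : 'I_(nb_components Q), fingraph.root adj i = comp_root k.
Proof.
have h : fingraph.root adj i \in predI (fingraph.roots adj) 'I_n.
  by rewrite !inE /= andbT; apply: (roots_root adjacent_connect_sym).
by exists (enum_rank_in h (fingraph.root adj i)); rewrite enum_rankK_in.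
Qed.

Lemma nb_components_connected : quiver_connected Q -> nb_components Q = 1%N.
Proof.
move=> [n0 hc]; rewrite -(n_comp_connect adjacent_connect_sym (Ordinal n0)).
by apply: eq_n_comp_r => i; rewrite !inE; apply/esym/hc.
Qed.

Lemma invariant_endomorphisms : iso_Ck G (H0_End_inv E) (nb_components Q).
Proof.
exists (fun k _ => component_endo k); split=> [c|s hs].
  apply: constant_section; rewrite sum_component_endo.
  apply: parabolic_ind.
  - split=> [|t X Y hX hY]; first by rewrite linear0 mulmx0 mul0mx.
    by rewrite linearP /= mulmxDr mulmxDl -scalemxAr -scalemxAl hX hY.
  - exact: diagonal_endo_levi.
  - apply/(diagonal_endo_nilrad Q hE) => i j ij; apply: eq_bigr => k _.
    congr (_ * (_ == _)%:R).
    by apply/(fingraph.rootP adjacent_connect_sym); apply: connect1.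
have [hconst hcomm] := invariant_section hs.
have [a ha] := levi_endomorphism hE (fun X hX => hcomm X (levi_sub hX)).
have eA : s 1%:M = diagonal_endo hE a.
  by apply: (eq_on_summands hE) => i; rewrite ha diagonal_endo_summand.
have acomp : forall i j, adj i j -> a i = a j.
  by apply/(diagonal_endo_nilrad Q hE) => Y hY; rewrite -eA; apply/hcomm/nilrad_sub.
exists (\row_k a (comp_root k)); split.
  move=> x Gx; rewrite hconst // eA sum_component_endo.
  apply: eq_bigr => i _; congr (_ *: _).
  have [k ek] := exists_comp_root i.
  under eq_bigr do rewrite mxE.
  by rewrite (sum_indicator (fun k => a (comp_root k)) ek) -ek connect_constant.
move=> c hc; apply/rowP => k; rewrite mxE.
have := hc 1%:M (analytic_one _).
rewrite eA sum_component_endo => /diagonal_endo_inj /(_ (comp_root k)) ->.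
exact: (sum_indicator (fun k => c 0 k) (root_comp_root k)).
Qed.

End Components.

Theorem propositionA (R : realType) (m : nat) (G : adeGroup R m)
    (P : parabolic G) (r : nat) (E : homBundle P r)
    (I : irrFamily P) (f : generators I)
    (D : gradedBundle E I) (Q : quiverRep f D)
    (hE : multiplicity_free D) :
  iso_Ck G (H0_End_inv E) (nb_components Q) /\
  (quiver_connected Q -> weakly_simple E).
Proof.
have h := invariant_endomorphisms Q hE; split=> // hQ.
by rewrite /weakly_simple -(nb_components_connected hQ).
Qed.
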